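(* Let $\phi$, $f$, $D$, $\bar\sigma$, $\varUpsilon$, $\gamma$, $\alpha$, $\tilde D$ and $D^\lambda=D+\lambda\tilde D$ ($\lambda>0$) be as in the context, and let $\sigma_s^\lambda$ be the value $\sigma_s$ associated with the flux $a^\lambda(u,s)=D^\lambda(u)\phi(s)$ and reaction $f$. Then $\bar\sigma<\sigma_s^\lambda$ when $\lambda$ is large enough.
   Context: Reaction: $f\in C^1[0,1]$, $f(0)=f(1)=0$, $f>0$ on $(0,1)$. Flux limiter: $\phi:\mathbb R\to(-1,1)$ is $C^1$, odd (so $\phi(0)=0$), $\phi'(s)>0$ for all $s$, $\lim_{s\to\pm\infty}\phi(s)=\pm1$, with $\phi'$ bounded. For a $C^2$ function $E:[0,1]\to[0,\infty)$ consider the flux $a(u,s)=E(u)\phi(s)$ on $[0,1]\times\mathbb R$, so that $a_+(u)=\lim_{s\to\infty}a(u,s)=E(u)$; for $E(u)>0$, $|v|<E(u)$ let $g(u,v)$ be given by $a(u,g(u,v))=v$. For $\sigma\ge0$ define $\Phi_e(u,R;\sigma)=2\sigma\sqrt R$ if $R\ge E(u)^2$; $=2\sqrt R\big(\sigma-\frac{f(u)}{g(u,\sqrt R)}\big)$ if $0<R<E(u)^2$; $=-2f(u)E(u)\phi'(0)$ if $R\le0$ and $R<E(u)^2$. There is a unique continuous (Carathéodory) solution $\mathcal R_\sigma:[0,1]\to\mathbb R$ of $\mathcal R(u)=-\int_u^1\Phi_e(\tau,\mathcal R(\tau);\sigma)\,d\tau$, it is nonnegative, and $\mathcal V_\sigma:=\sqrt{\mathcal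 R_\sigma}$. The value $\sigma_s$ associated with the flux $E(u)\phi(s)$ is $\sigma_s=\min\{\sigma>0:\mathcal V_\sigma(0)=0\}$ ($=\infty$ if there is none). (When $E>0$ on $[0,1]$, $\mathcal V_\sigma$ is the unique function in $C([0,1])\cap C^1((0,1))$, positive on $(0,1)$, with $\mathcal V_\sigma(1)=0$ and $\dot{\mathcal V}_\sigma=\sigma-f/g(u,\mathcal V_\sigma)$ where $\mathcal V_\sigma<E$, $\dot{\mathcal V}_\sigma=\sigma$ where $\mathcal V_\sigma\ge E$; the dot denotes $d/du$.) The function $D$. Let $0<u_2<u_1<1$. Let $D_1\in C^2[0,1]$ with $D_1=0$ on $[0,u_1]$ and $\ddot D_1>0$ on $(u_1,1]$; let $D_2\in C^2[0,1]$, $D_2\ge0$, with $D_2=0$ on $[u_2,1]$ and $\ddot D_2>0$ on $(0,u_2)$. Put $D=D_2$ on $[0,u_2)$, $D=0$ on $[u_2,u_1]$, $D=D_1$ on $(u_1,1]$. Let $\mathcal V^{(1)}_\sigma$ be the function $\mathcal V_\sigma$ for $E=D_1$, and let $\alpha_\sigma\in[0,1)$ be the smallest number such that $0<\mathcal V^{(1)}_\sigma<D_1$ on $(\alpha_\sigma,1)$. The equation $\sigma=\dot D_1(\alpha_\sigma)$ has a unique root $\tau>0$; for $\sigma\in(0,\tau)$ put $\beta_\sigma=\alpha_\sigma-\mathcal V^{(1)}_\sigma(\alpha_\sigma)/\sigma$, and let $\tilde\sigma\in(0,\tau)$ be the value with $\beta_{\tilde\sigma}=u_2$. Let $\sigma_s^{(2)}$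 be the value $\sigma_s$ for $E=D_2$. It is assumed that $D_1,D_2$ are chosen so that $\sigma_s^{(2)}<\tilde\sigma$. Let $\bar\sigma$ and $\varUpsilon$ be the value $\sigma_s$ and the function $\mathcal V_{\sigma_s}$ for $E=D$. Then $\bar\sigma<\infty$, $\varUpsilon>0$ on $(0,1)$ and there are $0<\gamma<u_2<u_1<\alpha<1$ with $\varUpsilon>D$ on $(\gamma,\alpha)$ and $\varUpsilon<D$ on $[0,\gamma)\cup(\alpha,1]$. Finally, $\tilde D:[0,1]\to[0,\infty)$ is a $C^2$ function whose support is the compact set $[\delta,\kappa]$, where $\gamma<\delta<u_2<u_1<\kappa<\alpha$, and the family is built so that for each $\lambda>0$ the flux $a^\lambda$ is regular, i.e. $a^\lambda\in C^1$ and $\frac{\partial a^\lambda}{\partial s}(u,s)>0$ for all $(u,s)\in[0,1]\times\mathbb R$, and $a^\lambda_+=D^\lambda$ is continuous on $[0,1]$. *)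

(* Defs.v *)
From HB Require Import structures.
From mathcomp Require Import all_boot all_order all_algebra.
From mathcomp Require Import all_classical all_reals all_analysis.

Set Implicit Arguments.
Unset Strict Implicit.
Unset Printing Implicit Defensive.

Import Order.TTheory GRing.Theory Num.Theory.
Import numFieldNormedType.Exports.

Local Open Scope classical_set_scope.
Local Open Scope ring_scope.

(* Functions on [0, 1] are total functions R -> R of which only the values on
   [0, 1] matter.  Derivatives are therefore taken within [0, 1]: two-sided in
   the interior, one-sided at 0 and 1. *)

Definition diffquot01 (R : realType) (h : R -> R) (u : R) : R -> R :=
  fun v => (h v - h u) / (v - u).

Definition derivable01 (R : realType) (h : R -> R) (u : R) : Prop :=
  cvg (diffquot01 h u v @[v --> within `[0, 1]%classic u^']).

Definition deriv01 (R : realType) (h : R -> R) (u : R) : R :=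
  lim (diffquot01 h u v @[v --> within `[0, 1]%classic u^']).

Definition C1_01 (R : realType) (h : R -> R) : Prop :=
  (forall u : R, 0 <= u <= 1 -> derivable01 h u) /\
  {within `[0, 1]%classic, continuous (deriv01 h)}.

Definition C2_01 (R : realType) (h : R -> R) : Prop :=
  C1_01 h /\ C1_01 (deriv01 h).

Definition support01 (R : realType) (h : R -> R) : set R :=
  closure [set u | 0 <= u <= 1 /\ h u != 0].

Definition reaction (R : realType) (f : R -> R) : Prop :=
  [/\ C1_01 f, f 0 = 0, f 1 = 0 & forall u : R, 0 < u < 1 -> 0 < f u].

Definition flux_limiter (R : realType) (phi : R -> R) : Prop :=
  [/\ forall s : R, -1 < phi s < 1,
      (forall s : R, derivable phi s 1) /\ continuous (derive1 phi),
      forall s : R, phi (- s) = - phi s,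
      forall s : R, 0 < derive1 phi s &
      [/\ phi s @[s --> +oo] --> (1 : R),
          phi s @[s --> -oo] --> (-1 : R) &
          exists M : R, forall s : R, `|derive1 phi s| <= M]].

Definition flux (R : realType) (E phi : R -> R) (u s : R) : R := E u * phi s.

(* A C^1 function on the strip [0, 1] x R, strictly increasing in s in the
   sense of a positive partial derivative *)
Definition regular_flux (R : realType) (a : R -> R -> R) : Prop :=
  let strip := (`[0, 1]%classic : set R) `*` (setT : set R) in
  [/\ forall u s : R, 0 <= u <= 1 -> derivable01 (fun w => a w s) u,
      forall u s : R, 0 <= u <= 1 -> derivable (a u) s 1,
      {within strip, continuous
         (fun p : R * R => deriv01 (fun w => a w p.2) p.1)},
      {within strip, continuous (fun p : R * R => derive1 (a p.1) p.2)} &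
      forall u s : R, 0 <= u <= 1 -> 0 < derive1 (a u) s].

(* g(u, v), the solution s of a(u, s) = v; only used when it exists and is
   unique, namely for E u > 0 and |v| < E u *)
Definition flux_inv (R : realType) (a : R -> R -> R) (u v : R) : R :=
  xget 0 [set s | a u s = v].

Definition Phi_e (R : realType) (f phi E : R -> R) (sigma u r : R) : R :=
  if E u ^+ 2 <= r then 2 * sigma * Num.sqrt r
  else if 0 < r then
    2 * Num.sqrt r * (sigma - f u / flux_inv (flux E phi) u (Num.sqrt r))
  else - 2 * f u * E u * derive1 phi 0.

Definition caratheodory_sol (R : realType) (f phi E : R -> R) (sigma : R)
    (r : R -> R) : Prop :=
  let rhs t := Phi_e f phi E sigma t (r t) in
  [/\ {within `[0, 1]%classic, continuous r},
      (@lebesgue_measure R).-integrable `[0, 1]%classic (EFin \o rhs) &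
      forall u : R, 0 <= u <= 1 ->
        r u = - \int[@lebesgue_measure R]_(t in `[u, 1]%classic) rhs t].

(* The solution exists and its restriction to [0, 1] is unique (for E of class
   C^2 and nonnegative, sigma >= 0), so the choice made by xget is immaterial
   on [0, 1]. *)
Definition Rsol (R : realType) (f phi E : R -> R) (sigma : R) : R -> R :=
  xget (cst 0) [set r | caratheodory_sol f phi E sigma r].

Definition Vsol (R : realType) (f phi E : R -> R) (sigma u : R) : R :=
  Num.sqrt (Rsol f phi E sigma u).

(* the least elements of A: empty or a singleton *)
Definition minima (R : realType) (A : set R) : set R := A `&` lbound A.

(* min {sigma > 0 : V_sigma(0) = 0}, and +oo if there is no minimum *)
Definition sigma_s (R : realType) (f phi E : R -> R) : \bar R :=
  xget +oo%E
    (EFin @` minima [set sigma | 0 < sigma /\ Vsol f phi E sigma 0 = 0]).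

Definition alpha_ (R : realType) (f phi D1 : R -> R) (sigma : R) : R :=
  xget 0 (minima [set a | 0 <= a < 1 /\
    forall u : R, a < u < 1 -> 0 < Vsol f phi D1 sigma u < D1 u]).

(* where the line of slope sigma through
   (alpha_sigma, V_sigma(alpha_sigma)) vanishes *)
Definition beta_ (R : realType) (f phi D1 : R -> R) (sigma : R) : R :=
  let a := alpha_ f phi D1 sigma in a - Vsol f phi D1 sigma a / sigma.

Definition glueD (R : realType) (u2 u1 : R) (D2 D1 : R -> R) (u : R) : R :=
  if u < u2 then D2 u else if u <= u1 then 0 else D1 u.

Definition Dlam (R : realType) (D Dt : R -> R) (lambda u : R) : R :=
  D u + lambda * Dt u.

(* Main.v *)
(* Only two facts about sigma_s are needed: sigma-bar is finite, and for large
   lambda no speed sigma <= sigma-bar makes V vanish at 0.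

   Where R > 0, V = sqrt R satisfies V' = sigma - f / g(u, V), and 1 / g is
   nonincreasing in V and nondecreasing in E.  Hence sqrt R1 - sqrt R2 decreases
   towards the left as long as it is positive (comparison principle, with an
   explicit Lipschitz dependence on sigma), and V (c) - V (b) <= sigma (c - b).
   Existence is Peano's theorem, the right hand side Phi_e being continuous.

   Large lambda: on a small interval where Dt > 0 one has R' <= - C lambda, so
   V becomes larger than sigma-bar, whereas V (0) = 0 would force
   V (u) <= sigma u <= sigma-bar.

   Finiteness: at sigma-tilde, V for D agrees with V for D1 on [u2, 1], which is
   the line of slope sigma-tilde on [u2, alpha] by convexity of D1 and thus
   vanishes at u2; to the left of u2 it is below V for D2, which vanishes at 0
   since sigma_s for D2 is smaller than sigma-tilde.  If sigma-bar were infinite,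
   Upsilon would be the solution with sigma = 0, positive at 0, so the infimum of
   the speeds with V (0) = 0 would be positive, and it is attained by the
   Lipschitz dependence on sigma. *)
Require Import Defs.
From HB Require Import structures.
From mathcomp Require Import all_boot all_order all_algebra.
From mathcomp Require Import all_classical all_reals all_analysis.
From mathcomp Require Import ring lra.

Set Implicit Arguments.
Unset Strict Implicit.
Unset Printing Implicit Defensive.

Import Order.TTheory GRing.Theory Num.Theory.
Import numFieldNormedType.Exports.

Local Open Scope classical_set_scope.
Local Open Scope ring_scope.

(** * Monotonicity from one-sided growth *)

(** Epsilon-delta differentiability with the denominator cleared, so that v = u needs no
    exclusion. *)
Lemma is_deriveP (R : realType) (w : R -> R) (u l : R) :
  is_derive u 1 w l <->
  (forall e : R, 0 < e -> exists2 d : R, 0 < d &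
     forall v : R, `|v - u| < d -> `|w v - w u - l * (v - u)| <= e * `|v - u|).
Proof.
split=> [[dw dE] e e0|H].
- have : h^-1 *: (w (h + u) - w u) @[h --> 0^'] --> l.
    move: dw; rewrite /derivable => /cvg_ex[l' hl'].
    have := hl'; move/cvg_lim => /(_ (@Rhausdorff R)) E.
    move: dE; rewrite /derive E => <-.
    apply: cvg_trans hl'; apply: near_eq_cvg; near=> h.
    by rewrite /= [h%:A]mulr1.
  move=> /cvgrPdist_le /(_ e e0); rewrite /dnbhs near_withinE.
  move=> /nbhs_ballP[d /= d0 Hd]; exists d => // v vd.
  have [->|vu] := eqVneq v u; first by rewrite !subrr mulr0 subrr normr0 mulr0.
  have vu0 : v - u != 0 by rewrite subr_eq0.
  have := Hd (v - u); rewrite /ball /= sub0r normrN => /(_ vd vu0).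
  rewrite subrK => h.
  have -> : w v - w u - l * (v - u) = - ((l - (v - u)^-1 *: (w v - w u)) * (v - u)).
    by rewrite mulrBl /GRing.scale /= mulrAC mulVf// mul1r opprB.
  by rewrite normrN normrM ler_wpM2r.
- have C : h^-1 *: (w (h%:A + u) - w u) @[h --> 0^'] --> l.
    apply/cvgrPdist_le => e e0; have [d d0 Hd] := H e e0.
    rewrite /dnbhs near_withinE; apply/nbhs_ballP; exists d => //= h.
    rewrite /ball /= sub0r normrN => hd h0.
    have := Hd (h + u); rewrite addrK => /(_ hd).
    rewrite [h%:A]mulr1.
    have -> : w (h + u) - w u - l * h = - ((l - h^-1 *: (w (h + u) - w u)) * h).
      by rewrite mulrBl /GRing.scale /= mulrAC mulVf// mul1r opprB.
    by rewrite normrN normrM ler_pM2r ?normr_gt0.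
  split; first by apply/cvg_ex; exists l.
  by apply/cvg_lim => //; exact: Rhausdorff.
Unshelve. all: by end_near.
Qed.

(** Supplies the Dini hypothesis of [right_dini_le]: an error below half of the slope gap l - m
    still leaves a strict gain. *)
Lemma is_derive_right_gt (R : realType) (w : R -> R) (u l m c : R) :
  is_derive u 1 w l -> m < l -> u < c ->
  exists2 v, u < v < c & w u + m * (v - u) < w v.
Proof.
move=> /is_deriveP H ml uc.
have [d d0 Hd] : exists2 d : R, 0 < d &
   forall v : R, `|v - u| < d ->
     `|w v - w u - l * (v - u)| <= (l - m) / 2 * `|v - u|.
  by apply: H; lra.
have t0 : 0 < Num.min d (c - u) by rewrite lt_min d0 subr_gt0.
have [td tc] : Num.min d (c - u) <= d /\ Num.min d (c - u) <= c - u.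
  by split; rewrite ge_min lexx ?orbT.
set t := Num.min d (c - u) in t0 td tc.
exists (u + t / 2); first lra.
have := Hd (u + t / 2); rewrite (addrC u) addrK gtr0_norm; last lra.
have ht : 0 < (l - m) * (t / 2) by rewrite mulr_gt0//; lra.
by move=> /(_ ltac:(lra)); rewrite ler_norml => /andP[h _]; nra.
Qed.

(** Mirror image, feeding [left_increase_le]: to the left, a slope [m] larger than the derivative
    gives the lower line. *)
Lemma is_derive_left_gt (R : realType) (w : R -> R) (u l m c : R) :
  is_derive u 1 w l -> l < m -> c < u ->
  exists2 v, c < v < u & w u + m * (v - u) < w v.
Proof.
move=> /is_deriveP H ml uc.
have [d d0 Hd] : exists2 d : R, 0 < d &
   forall v : R, `|v - u| < d ->
     `|w v - w u - l * (v - u)| <= (m - l) / 2 * `|v - u|.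
  by apply: H; lra.
have t0 : 0 < Num.min d (u - c) by rewrite lt_min d0 subr_gt0.
have [td tc] : Num.min d (u - c) <= d /\ Num.min d (u - c) <= u - c.
  by split; rewrite ge_min lexx ?orbT.
set t := Num.min d (u - c) in t0 td tc.
exists (u - t / 2); first lra.
have := Hd (u - t / 2); rewrite (addrC u) addrK normrN gtr0_norm; last lra.
have ht : 0 < (m - l) * (t / 2) by rewrite mulr_gt0//; lra.
by move=> /(_ ltac:(lra)); rewrite ler_norml => /andP[h _]; nra.
Qed.

Lemma within_subspace (R : realType) (w : R -> R) (a b c d : R) :
  c <= a -> b <= d ->
  {within `[c, d], continuous w} -> {within `[a, b], continuous w}.
Proof.
move=> ca bd; apply: continuous_subspaceW => x /=.
by rewrite !in_itv/= => /andP[ax xb]; rewrite (le_trans ca ax) (le_trans xb bd).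
Qed.

(* Only positive values of [w] matter, and the growth condition is a lower
   right Dini derivative bound, so that [w] may fail to be differentiable. *)
Lemma right_dini_le (R : realType) (w : R -> R) (b c : R) : b <= c ->
  {within `[b, c], continuous w} ->
  (forall u, b < u < c -> 0 < w u -> forall e, 0 < e ->
     exists2 v, u < v < c & w u - e * (v - u) < w v) ->
  w b <= Num.max 0 (w c).
Proof.
rewrite le_eqVlt => /predU1P[->|bc] cw H; first by rewrite le_max lexx orbT.
rewrite leNgt; apply/negP => wbm.
set m := Num.max 0 (w c) in wbm.
(* The growth condition is available only at interior points, so the maximum below is sought on
   [b', c] with b' > b. *)
have [b' b'bc wb'] : exists2 b', b < b' < c & m < w b'.
  have : w x @[x --> b^'+] --> w b.
    by have [/(_ cw)[]] := continuous_within_itvP w bc.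
  move=> /cvgrPdist_lt /(_ (w b - m)); rewrite subr_gt0 => /(_ wbm) wn.
  have [x [bx xc wx]] : exists x, [/\ b < x, x < c & `|w b - w x| < w b - m].
    near (b^'+) => x; exists x; split; near: x => //.
    exact: nbhs_right_gt.
    exact: nbhs_right_lt.
  exists x; first by rewrite bx.
  by move: wx; rewrite ltr_norml => /andP[_]; lra.
(* With this tilt the maximiser [s] of [z] has w s >= (w b' + m) / 2 > m, which excludes s = c and
   makes w s positive. Growth at [s] with loss e / 2 then contradicts maximality. *)
have e0 : 0 < (w b' - m) / 2 / (c - b') by rewrite !divr_gt0//; lra.
set e := (w b' - m) / 2 / (c - b') in e0.
have eE : e * (c - b') = (w b' - m) / 2 by rewrite /e divfK//; lra.
pose z x := w x + e * x.
have cz : {within `[b', c], continuous z}.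
  move=> x; apply: cvgD.
    by apply: (@within_subspace _ _ _ _ b c); [lra|lra|exact: cw].
  by apply: cvgM; [exact: cvg_cst|apply: continuous_subspaceT => y; exact: cvg_id].
have [|s] := @EVT_max _ z b' c _ cz; first lra.
rewrite in_itv/= => /andP[b's sc] smax.
have zb' : z b' <= z s by apply: smax; rewrite in_itv/= lexx; lra.
have m0 : 0 <= m by rewrite le_max lexx.
have wcm : w c <= m by rewrite le_max lexx orbT.
rewrite /z in zb'.
have h1 : e * s <= e * c by rewrite ler_pM2l.
have [scE|sc'] := eqVneq s c.
  by rewrite scE in zb'; lra.
have sltc : s < c by rewrite lt_neqAle sc'.
have ws : 0 < w s by lra.
have [||v vs wv] := H s _ ws (e / 2); [lra|lra|].
have := smax v; rewrite in_itv/= /z => /(_ ltac:(lra)).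
have : 0 < e * (v - s) by rewrite mulr_gt0//; lra.
lra.
Unshelve. all: by end_near.
Qed.

(** If q c > q b, a maximiser of [q] lies to the right of b with value above q b, and the hypothesis
    produces a larger value to its left. *)
Lemma left_increase_le (R : realType) (q : R -> R) (b c : R) : b <= c ->
  {within `[b, c], continuous q} ->
  (forall u, b < u <= c -> q b < q u -> exists2 v, b < v < u & q u < q v) ->
  q c <= q b.
Proof.
move=> bc cq H; rewrite leNgt; apply/negP => qbc.
have [s] := @EVT_max _ q b c bc cq.
rewrite in_itv/= => /andP[bs sc] smax.
have qs : q b < q s.
  by apply: (lt_le_trans qbc); apply: smax; rewrite in_itv/= lexx bc.
have bs' : b < s.
  by rewrite lt_neqAle bs andbT; apply/eqP => E; rewrite E ltxx in qs.
have [|v vs qv] := H s _ qs; first by rewrite bs'.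
by have := smax v; rewrite in_itv/= => /(_ ltac:(lra)); lra.
Qed.

(** * The inverse of the flux *)

(* [1 / g(u, v)] as a function of [E = E u], set to [0] for [v >= E u] *)
Definition recip_g (R : realType) (phi : R -> R) (E v : R) : R :=
  if E <= v then 0 else (xget 0 [set s | E * phi s = v])^-1.

(* [sqrt r / g(u, sqrt r)], extended by its limit as [r] decreases to [0] *)
Definition ratio_g (R : realType) (phi : R -> R) (E r : R) : R :=
  if 0 < r then Num.sqrt r * recip_g phi E (Num.sqrt r) else E * derive1 phi 0.

(** Merges the three cases of [Phi_e] into one expression, whose continuity reduces to that of
    [ratio_g]. *)
Lemma Phi_eE (R : realType) (f phi E : R -> R) (sigma u r : R) : 0 <= E u ->
  Phi_e f phi E sigma u r =
  2 * sigma * Num.sqrt r - 2 * f u * ratio_g phi (E u) r.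
Proof.
move=> E0; rewrite /Phi_e /ratio_g /recip_g /flux_inv /flux.
(* The two tests differ only for E u = 0 and r < 0, because [Num.sqrt] is 0 on negative numbers. *)
have EE : (E u <= Num.sqrt r) = (E u ^+ 2 <= r) || ((E u == 0) && (r <= 0)).
  have [r0|r0] := leP 0 r.
    rewrite -{2}(sqr_sqrtr r0) ler_sqr ?nnegrE ?sqrtr_ge0//.
    have [->|] := eqVneq (E u) 0; first by rewrite sqrtr_ge0.
    by rewrite orbF.
  rewrite ler0_sqrtr ?(ltW r0)// andbT (le_eqVlt (E u)).
  by rewrite (ltNge (E u)) E0 orbF [_ ^+ 2 <= r]leNgt (lt_le_trans r0) ?sqr_ge0.
case: ifPn => Er.
  have r0 : 0 <= r by rewrite (le_trans _ Er)// sqr_ge0.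
  rewrite EE Er /=; case: ifPn => r1; first by rewrite !mulr0 subr0.
  have rE : r = 0 by apply/eqP; rewrite eq_le r0 leNgt r1.
  move: Er; rewrite rE => E00.
  have -> : E u = 0.
    by apply/eqP; rewrite -sqrf_eq0 eq_le E00 sqr_ge0.
  by rewrite !(mul0r, mulr0, subr0).
rewrite EE (negbTE Er) /=; case: ifPn => r0; last first.
  rewrite -leNgt in r0.
  by rewrite (ler0_sqrtr r0) mulr0 sub0r !mulrA !mulNr.
by rewrite (leNgt r) r0 andbF; ring.
Qed.

Section FluxLimiter.
Context {R : realType} {phi : R -> R}.
Hypothesis hphi : flux_limiter phi.

Lemma is_derive_phi (s : R) : is_derive s 1 phi (derive1 phi s).
Proof.
have [_ [d _] _ _ _] := hphi; rewrite derive1E.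
exact: DeriveDef.
Qed.

Lemma continuous_phi : continuous phi.
Proof.
move=> s; apply: differentiable_continuous; apply/derivable1_diffP.
by have [_ [d _] _ _ _] := hphi.
Qed.

Lemma phi_MVT (a b : R) : a < b ->
  exists2 c, a < c < b & phi b - phi a = derive1 phi c * (b - a).
Proof.
move=> ab; have [||c cab E] := @MVT _ phi (derive1 phi) a b ab.
- by move=> x _; exact: is_derive_phi.
- by apply: continuous_subspaceT; exact: continuous_phi.
by exists c => //; move: cab; rewrite in_itv.
Qed.

Lemma phi_lt (s t : R) : (phi s < phi t) = (s < t).
Proof.
have H (a b : R) : a < b -> phi a < phi b.
  have [_ _ _ dp _] := hphi.
  move=> ab; have [c _ E] := phi_MVT ab; rewrite -subr_gt0 E.
  by rewrite mulr_gt0// subr_gt0.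
apply/idP/idP => [|/H//]; rewrite ltNge => h; rewrite ltNge; apply: contra h.
by rewrite le_eqVlt => /predU1P[->//|/H/ltW].
Qed.

Lemma phi0 : phi 0 = 0.
Proof. by have [_ _ /(_ 0) + _ _] := hphi; rewrite oppr0 => h; lra. Qed.

Lemma phi_gt0 (s : R) : (0 < phi s) = (0 < s).
Proof. by rewrite -{1}phi0 phi_lt. Qed.

Lemma phi_surj (y : R) : 0 < y < 1 -> exists2 s, 0 < s & phi s = y.
Proof.
move=> /andP[y0 y1]; have [_ _ _ _ [ply _ _]] := hphi.
have [b [b0 yb]] : exists b, 0 < b /\ y < phi b.
  have : \forall s \near +oo, y < phi s by apply: cvgr_gt ply _ y1.
  move=> H; near (@pinfty_nbhs R) => s; exists s; split; near: s => //.
  exact: nbhs_pinfty_gt.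
have [|||c] := @IVT _ phi 0 b y _ _ _; first exact: ltW.
- by apply: continuous_subspaceT; exact: continuous_phi.
- by rewrite phi0 min_l ?max_r ?(ltW y0) ?(ltW yb)// (le_trans (ltW y0) (ltW yb)).
rewrite in_itv/= => _ cE; exists c => //.
by rewrite -phi_gt0 cE.
Unshelve. all: by end_near.
Qed.

(** Both linear bounds come from the mean value theorem: [M] bounds phi' and [c] is its minimum on
    [0, 1]. The lower one is confined to a bounded range of s because phi is bounded. *)
Lemma phi_bounds : exists M c : R, [/\ 0 < c, c <= derive1 phi 0 <= M,
  forall s, 0 < s -> phi s <= M * s & forall s, 0 < s <= 1 -> c * s <= phi s].
Proof.
have [_ [_ cd] _ dp [_ _ [M hM]]] := hphi.
have [|c c01 cmin] := @EVT_min _ (derive1 phi) 0 1 ler01.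
  exact: continuous_subspaceT.
exists M, (derive1 phi c); split => //.
- rewrite cmin ?in_itv/= ?lexx ?ler01//.
  by rewrite (le_trans (ler_norm _) (hM _)).
- move=> s s0; have [d _] := phi_MVT s0; rewrite phi0 !subr0 => ->.
  by rewrite ler_pM2r// (le_trans (ler_norm _) (hM _)).
move=> s /andP[s0 s1]; have [d ds] := phi_MVT s0; rewrite phi0 !subr0 => ->.
by rewrite ler_pM2r// cmin// in_itv/=; lra.
Qed.

Lemma recip_gP (E v : R) : 0 < v < E ->
  exists s, [/\ 0 < s, E * phi s = v & recip_g phi E v = s^-1].
Proof.
move=> /andP[v0 vE]; have E0 := lt_trans v0 vE.
have [|s s0 sE] := @phi_surj (v / E).
  by rewrite divr_gt0//= ltr_pdivrMr// mul1r.
have sv : E * phi s = v by rewrite sE mulrC divfK// gt_eqF.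
exists s; split=> //; rewrite /recip_g leNgt vE /=; congr _^-1.
case: xgetP => [t _ /= tE|/(_ s)//].
have : phi t = phi s by apply: (mulfI (lt0r_neq0 E0)); rewrite tE sv.
by case: (ltgtP t s) => //; rewrite -phi_lt => + h; rewrite h ltxx.
Qed.

Lemma recip_g_ge0 (E v : R) : 0 < v -> 0 <= recip_g phi E v.
Proof.
move=> v0; have [Ev|vE] := leP E v; first by rewrite /recip_g Ev.
by have [|s [s0 _ ->]] := @recip_gP E v; [rewrite v0|rewrite invr_ge0 ltW].
Qed.

(** Comparing 1 / g with 1 / s becomes a comparison of v with E phi(s), free of the inverse
    function. Monotonicity and continuity of [recip_g] both follow from this and from
    [recip_g_gt]. *)
Lemma recip_g_lt (E v s : R) : 0 <= E -> 0 < v -> 0 < s ->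
  (recip_g phi E v < s^-1) = (E * phi s < v).
Proof.
move=> E0 v0 s0; have [Ev|vE] := leP E v.
  rewrite /recip_g Ev invr_gt0 s0; apply/esym.
  move: E0; rewrite le_eqVlt => /predU1P[<-|E0]; first by rewrite mul0r.
  rewrite (lt_le_trans _ Ev)// gtr_pMr//.
  by have [/(_ s)/andP[]] := hphi.
have [|t [t0 tE ->]] := @recip_gP E v; first by rewrite v0.
by rewrite ltf_pV2 ?posrE// -tE ltr_pM2l ?phi_lt// (lt_trans v0).
Qed.

Lemma recip_g_gt (E v s : R) : 0 <= E -> 0 < v -> 0 < s ->
  (s^-1 < recip_g phi E v) = (v < E * phi s).
Proof.
move=> E0 v0 s0; have [Ev|vE] := leP E v.
  rewrite /recip_g Ev invr_lt0 (ltNge s) (ltW s0)/=; apply/esym.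
  apply/negbTE; rewrite -leNgt (le_trans _ Ev)// ler_piMr//.
  by have [/(_ s)/andP[_ /ltW]] := hphi.
have [|t [t0 tE ->]] := @recip_gP E v; first by rewrite v0.
by rewrite ltf_pV2 ?posrE// -tE ltr_pM2l ?phi_lt// (lt_trans v0).
Qed.

Lemma le_recip_g (E1 E2 v1 v2 : R) : 0 <= E1 <= E2 -> 0 < v2 <= v1 ->
  recip_g phi E1 v1 <= recip_g phi E2 v2.
Proof.
move=> /andP[E10 E12] /andP[v20 v21]; rewrite leNgt; apply/negP => h.
have v10 := lt_le_trans v20 v21.
(* At s = 1 / m, with [m] strictly between the two values, E1 phi(s) > v1 >= v2 > E2 phi(s), against
   E1 <= E2. *)
pose m := (recip_g phi E1 v1 + recip_g phi E2 v2) / 2.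
have r0 := recip_g_ge0 E2 v20.
have m0 : 0 < m by rewrite /m; lra.
have : recip_g phi E2 v2 < (m^-1)^-1 by rewrite invrK /m; lra.
have : (m^-1)^-1 < recip_g phi E1 v1 by rewrite invrK /m; lra.
rewrite recip_g_gt ?invr_gt0// recip_g_lt ?invr_gt0//; last exact: le_trans E12.
move=> a b.
have : E1 * phi m^-1 <= E2 * phi m^-1.
  by rewrite ler_wpM2r// ltW// phi_gt0 invr_gt0.
lra.
Qed.

(** With v = E phi(s) the ratio equals E phi(s) / s. Linearity of the bound in E is what gives
    continuity at E = 0. *)
Lemma ratio_g_bounds : exists2 M : R, 0 < M &
  forall E r, 0 <= E -> 0 <= ratio_g phi E r <= M * E.
Proof.
have [M [c [c0 /andP[cd dM] phiM _]]] := phi_bounds.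
exists M => [|E r E0]; first lra.
rewrite /ratio_g; case: ifPn => r0; last first.
  by rewrite mulr_ge0//=; [rewrite mulrC ler_wpM2r|lra].
have v0 : 0 < Num.sqrt r by rewrite sqrtr_gt0.
rewrite mulr_ge0 ?recip_g_ge0 ?(ltW v0)//=.
have [Ev|vE] := leP E (Num.sqrt r).
  by rewrite /recip_g Ev mulr0 mulr_ge0//; lra.
have [|s [s0 sE ->]] := @recip_gP E (Num.sqrt r); first by rewrite v0.
rewrite ler_pdivrMr// -sE mulrAC mulrC ler_wpM2r//.
by rewrite phiM.
Qed.

End FluxLimiter.

(** Joint continuity of [ratio_g] in (E, r), including the points where E = 0 and where r changes
    sign; Peano's theorem and the passage between integral and differential equations rest on it. *)
Lemma ratio_g_cvg (R : realType) (phi : R -> R) (hphi : flux_limiter phi)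
    (T : Type) (F : set_system T) (FF : Filter F) (e r : T -> R) (e0 r0 : R) :
  (forall x, 0 <= e x) -> 0 <= e0 -> e x @[x --> F] --> e0 ->
  r x @[x --> F] --> r0 ->
  ratio_g phi (e x) (r x) @[x --> F] --> ratio_g phi e0 r0.
Proof.
move=> e_ge0 e0_ge0 ce cr.
move: e0_ge0; rewrite le_eqVlt => /predU1P[e0E|e0_gt0].
  rewrite -{}e0E in ce *.
  have [M M0 hM] := ratio_g_bounds hphi.
  have -> : ratio_g phi 0 r0 = 0.
    by apply/le_anti; have := hM 0 r0 (lexx 0); rewrite mulr0 andbC.
  apply: (@squeeze_cvgr _ _ _ _ (cst 0) (fun x => M * e x)).
  - by apply: nearW => x; exact: hM.
  - exact: cvg_cst.
  - by rewrite -(mulr0 M); apply: cvgMr.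
have [r0_gt0|] := ltP 0 r0; last first.
  rewrite le_eqVlt => /predU1P[r0E|r0_lt0]; last first.
    rewrite {2}/ratio_g ltNge (ltW r0_lt0)/=.
    apply: (@cvg_trans _ (e x * phi^`()%classic 0 @[x --> F])).
      apply: near_eq_cvg; near=> x; rewrite /ratio_g ltNge.
      suff -> : r x <= 0 by [].
      near: x; apply: cvgr_le cr _ r0_lt0.
    exact: cvgMl.
  (* Critical case r0 = 0: as r decreases to 0 so does s = g(e, sqrt r), and the ratio e phi(s) / s
     tends to e0 phi'(0). *)
  rewrite {}r0E in cr *; rewrite {2}/ratio_g ltxx.
  apply/cvgrPdist_le => eps eps0.
  pose k := eps / 2 / (2 * e0).
  have k0 : 0 < k by rewrite !divr_gt0// mulr_gt0.
  have [d d0 Hd] := (is_deriveP _ _ _).1 (is_derive_phi hphi 0) k k0.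
  have : e x * phi^`()%classic 0 @[x --> F] --> e0 * phi^`()%classic 0.
    exact: cvgMl.
  move=> /cvgrPdist_le/(_ (eps / 2)) => /(_ ltac:(lra)) H1.
  (* For e > e0 / 2, sqrt r < t gives e phi(s) < e phi(d / 2), hence s < d / 2, inside the range of
     the derivative estimate. *)
  pose t := e0 / 2 * phi (d / 2).
  have pd0 : 0 < phi (d / 2) by rewrite (phi_gt0 hphi); lra.
  have t0 : 0 < t by rewrite mulr_gt0//; lra.
  have H2 : \forall x \near F, r x < t ^+ 2.
    by apply: cvgr_lt cr _ _; rewrite exprn_gt0.
  have H3 : \forall x \near F, e0 / 2 < e x by apply: cvgr_gt ce _ _; lra.
  have H4 : \forall x \near F, e x < 2 * e0 by apply: cvgr_lt ce _ _; lra.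
  near=> x.
  have h1 : `|e0 * phi^`()%classic 0 - e x * phi^`()%classic 0| <= eps / 2.
    by near: x.
  have h2 : r x < t ^+ 2 by near: x.
  have h3 : e0 / 2 < e x by near: x.
  have h4 : e x < 2 * e0 by near: x.
  have [rx0|rx0] := ltP 0 (r x); last first.
    by rewrite {1}/ratio_g ltNge rx0/= (le_trans h1)//; lra.
  rewrite {1}/ratio_g rx0.
  have sx0 : 0 < Num.sqrt (r x) by rewrite sqrtr_gt0.
  have sxt : Num.sqrt (r x) < t.
    by rewrite -[ltRHS](gtr0_norm t0) -sqrtr_sqr ltr_sqrt// exprn_gt0.
  have sx2 : Num.sqrt (r x) < e x * phi (d / 2).
    apply: (lt_le_trans sxt); rewrite /t ler_pM2r//; lra.
  have sxe : Num.sqrt (r x) < e x.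
    apply: (lt_trans sx2); rewrite gtr_pMr; last lra.
    by have [/(_ (d / 2))/andP[]] := hphi.
  have [|s [s0 sE ->]] := @recip_gP _ _ hphi (e x) (Num.sqrt (r x)).
    by rewrite sx0.
  have sd : s < d / 2.
    by rewrite -(phi_lt hphi) -(ltr_pM2l (lt_trans sx0 sxe)) sE.
  have := Hd s; rewrite (phi0 hphi) !subr0 gtr0_norm// => /(_ ltac:(lra)) h5.
  have -> : Num.sqrt (r x) / s = e x * phi^`()%classic 0
      + e x * ((phi s - phi^`()%classic 0 * s) / s).
    by rewrite -sE; field; rewrite gt_eqF.
  have h6 : `|e x * ((phi s - phi^`()%classic 0 * s) / s)| <= eps / 2.
    rewrite !normrM normfV (gtr0_norm s0) (gtr0_norm (lt_trans sx0 sxe)).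
    have : `|phi s - phi^`()%classic 0 * s| / s <= k by rewrite ler_pdivrMr.
    move=> h6; apply: (@le_trans _ _ (2 * e0 * k)).
      by apply: ler_pM => //; [
         rewrite divr_ge0// ltW|exact: ltW].
    by rewrite /k mulrC divfK// gt_eqF// mulr_gt0.
  rewrite opprD addrA; apply: (le_trans (ler_normB _ _)); lra.
rewrite {2}/ratio_g r0_gt0.
have cs : Num.sqrt (r x) @[x --> F] --> Num.sqrt r0.
  exact: continuous_cvg (@sqrt_continuous R r0) cr.
have s0 : 0 < Num.sqrt r0 by rewrite sqrtr_gt0.
apply: (@cvg_trans _ (Num.sqrt (r x) * recip_g phi (e x) (Num.sqrt (r x))
    @[x --> F])).
  apply: near_eq_cvg; near=> x; rewrite /ratio_g.
  suff -> : 0 < r x by [].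
  by near: x; apply: cvgr_gt cr _ r0_gt0.
apply: cvgM => //; apply/cvgrPdist_le => eps eps0.
set p0 := recip_g _ _ _.
have p0_ge0 : 0 <= p0 by exact: recip_g_ge0.
(* By [recip_g_lt] and [recip_g_gt] at s = 1 / (p0 + eps) and s = 1 / (p0 - eps), each one-sided
   bound is a strict sign of sqrt r - e phi(s), which persists near the limit. *)
have ced (s : R) : Num.sqrt (r x) - e x * phi s @[x --> F]
    --> Num.sqrt r0 - e0 * phi s.
  by apply: cvgB => //; apply: cvgMl.
have H0 : \forall x \near F, 0 < Num.sqrt (r x) by apply: cvgr_gt cs _ s0.
have H1 : \forall x \near F, recip_g phi (e x) (Num.sqrt (r x)) < p0 + eps.
  have q0 : 0 < p0 + eps by lra.
  near=> x; rewrite -(invrK (p0 + eps)) recip_g_lt ?invr_gt0//; last by near: x.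
  rewrite -subr_gt0; near: x; apply: cvgr_gt (ced _) _ _.
  by rewrite subr_gt0 -(recip_g_lt hphi) ?invr_gt0 ?ltW// invrK -/p0; lra.
have H2 : \forall x \near F, p0 - eps <= recip_g phi (e x) (Num.sqrt (r x)).
  have [q0|q0] := ltP 0 (p0 - eps); last first.
    near=> x; apply: (le_trans q0); apply: (recip_g_ge0 hphi).
    by near: x.
  near=> x; apply: ltW.
  rewrite -(invrK (p0 - eps)) recip_g_gt ?invr_gt0//; last by near: x.
  rewrite -subr_lt0; near: x; apply: cvgr_lt (ced _) _ _.
  by rewrite subr_lt0 -(recip_g_gt hphi) ?invr_gt0 ?ltW// invrK -/p0; lra.
near=> x.
have h1 : recip_g phi (e x) (Num.sqrt (r x)) < p0 + eps by near: x.
have h2 : p0 - eps <= recip_g phi (e x) (Num.sqrt (r x)) by near: x.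
by rewrite ler_norml; lra.
Unshelve. all: by end_near.
Qed.

(** * Peano's existence theorem *)

(** Tychonoff's theorem replaces Arzela-Ascoli: a cluster point in a compact product of segments is
    approximated at two points at once by terms of arbitrarily large index. Two points suffice for
    estimates on increments. *)
Lemma pointwise_cluster (R : realType) (u : nat -> R -> R) (B : R -> R) :
  (forall n t, `|u n t| <= B t) ->
  exists y : R -> R, forall (s t eps : R) (N : nat), 0 < eps ->
    exists2 n, (N <= n)%N & `|u n s - y s| < eps /\ `|u n t - y t| < eps.
Proof.
move=> uB.
have := @tychonoff R (fun _ => R) (fun t => `[- B t, B t]%classic)
  (fun t => @segment_compact R _ _).
set K := [set f | _] => Kc.
pose F := (fun n => u n : prod_topology (fun _ : R => R)) @ \oo.
have FK : F K.
  exists 0%N => // n _ t /=; rewrite in_itv/=.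
  by have := uB n t; rewrite ler_norml.
have [y [_ yc]] := Kc F _ FK.
exists y => s t eps N eps0.
have nb (p : R) : nbhs (y : prod_topology (fun _ : R => R))
    [set g : prod_topology (fun _ : R => R) | `|g p - y p| < eps].
  have bp : nbhs (y p) [set x : R | `|x - y p| < eps].
    by apply/nbhs_ballP; exists eps => // x; rewrite /ball /= distrC.
  exact: (@proj_continuous R (fun _ => R) p y _ bp).
have FN : F [set g | exists2 n, (N <= n)%N & g = u n].
  by exists N => // n Nn; exists n.
have [g [[n Nn ->] [gs gt]]] := yc _ _ FN (filterI (nb s) (nb t)).
by exists n.
Qed.

Fixpoint euler_seq (R : realType) (G : R -> R -> R) (h : R) (k : nat) : R :=
  if k is k'.+1 then
    euler_seq G h k' + h * G (k'%:R * h) (euler_seq G h k')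
  else 0.

Lemma euler_seq_increment (R : realType) (G : R -> R -> R) (h G0 e : R)
    (k m : nat) : 0 <= h ->
  (forall j, (k <= j < k + m)%N ->
     `|G (j%:R * h) (euler_seq G h j) - G0| <= e) ->
  `|euler_seq G h (k + m) - euler_seq G h k - m%:R * h * G0| <= m%:R * h * e.
Proof.
move=> h0; elim: m => [|m IH] H.
  by rewrite addn0 subrr !mul0r subrr normr0.
rewrite addnS /=; set a := euler_seq G h (k + m).
have -> : a + h * G ((k + m)%:R * h) a - euler_seq G h k - m.+1%:R * h * G0 =
    (a - euler_seq G h k - m%:R * h * G0) + h * (G ((k + m)%:R * h) a - G0).
  by rewrite -natr1; ring.
rewrite (le_trans (ler_normD _ _))// -natr1 !mulrDl mul1r lerD//.
  by apply: IH => j /andP[kj jm]; rewrite H// kj addnS ltnS ltnW.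
by rewrite normrM ger0_norm// ler_wpM2l// H// leq_addr addnS ltnS/=.
Qed.

(** Piecewise constant Euler approximation with step 1 / (n + 1). Since it jumps, estimates on it
    carry an extra term of the order of the step. *)
Definition euler_step (R : realType) (G : R -> R -> R) (n : nat) (s : R) : R :=
  euler_seq G n.+1%:R^-1 (Num.truncn (s * n.+1%:R)).

(** Both p and q are rounded down to the grid, so the grid points visited lie in [p - h, q] and
    their total length differs from q - p by less than the step h; this costs the last term. *)
Lemma euler_step_increment (R : realType) (G : R -> R -> R) (n : nat)
    (G0 e p q : R) : 0 <= p <= q -> 0 <= e ->
  (forall k, (Num.truncn (p * n.+1%:R) <= k)%N ->
     p - n.+1%:R^-1 <= k%:R * n.+1%:R^-1 <= q ->
     `|G (k%:R * n.+1%:R^-1) (euler_seq G n.+1%:R^-1 k) - G0| <= e) ->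
  `|euler_step G n q - euler_step G n p - (q - p) * G0| <=
    (q - p) * e + n.+1%:R^-1 * (e + `|G0|).
Proof.
move=> /andP[p0 pq] e0 H; rewrite /euler_step.
set h : R := _^-1 in H *.
have N0 : 0 < n.+1%:R :> R by rewrite ltr0n.
have h0 : 0 < h by rewrite invr_gt0.
have hN : n.+1%:R * h = 1 by rewrite divff// gt_eqF.
set k := Num.truncn _ in H *; set l := Num.truncn _.
have /andP[k1 k2] : k%:R <= p * n.+1%:R < k.+1%:R.
  by apply: truncn_itv; rewrite mulr_ge0// ltW.
have /andP[l1 l2] : l%:R <= q * n.+1%:R < l.+1%:R.
  by apply: truncn_itv; rewrite mulr_ge0 ?(ltW N0)// (le_trans p0).
have kl : (k <= l)%N by rewrite le_truncn// ler_wpM2r// ltW.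
have scale (x : R) : x = x * n.+1%:R * h by rewrite -mulrA hN mulr1.
have succ (j : nat) : j%:R * h + h = j.+1%:R * h by rewrite -natr1 mulrDl mul1r.
have lq : l%:R * h <= q by rewrite [leRHS]scale ler_pM2r.
have lq' : q < l%:R * h + h.
  by rewrite [ltLHS]scale succ ltr_pM2r.
have kp : k%:R * h <= p by rewrite [leRHS]scale ler_pM2r.
have kp' : p < k%:R * h + h.
  by rewrite [ltLHS]scale succ ltr_pM2r.
have [m lE] : exists m, l = (k + m)%N by exists (l - k)%N; rewrite subnKC.
have mE : m%:R * h = l%:R * h - k%:R * h by rewrite lE natrD mulrDl addrC addKr.
have incr : `|euler_seq G h l - euler_seq G h k - m%:R * h * G0| <= m%:R * h * e.
  rewrite lE; apply: euler_seq_increment; first exact: ltW.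
  move=> j /andP[kj jkm]; apply: H => //; apply/andP; split.
    have : k%:R * h <= j%:R * h by rewrite ler_pM2r// ler_nat.
    lra.
  apply: le_trans lq; rewrite ler_pM2r// ler_nat lE.
  exact: ltnW.
have mh : `|(m%:R * h - (q - p)) * G0| <= h * `|G0|.
  by rewrite normrM ler_wpM2r// mE ler_norml; lra.
have -> : euler_seq G h l - euler_seq G h k - (q - p) * G0 =
    (euler_seq G h l - euler_seq G h k - m%:R * h * G0) +
    (m%:R * h - (q - p)) * G0 by ring.
have me : m%:R * h * e <= (q - p + h) * e by rewrite ler_wpM2r// mE; lra.
by rewrite (le_trans (ler_normD _ _))//; lra.
Qed.

(** The Euler approximations are Lipschitz up to a multiple of the step, so a cluster point is
    Lipschitz. Near (s, y s) the slopes used are close to G s (y s), which yields the derivative. *)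
Lemma peano (R : realType) (G : R -> R -> R) (M : R) :
  (forall s y, `|G s y| <= M) ->
  continuous (fun p : R * R => G p.1 p.2) ->
  exists y : R -> R, [/\ y 0 = 0,
    forall s t : R, 0 <= s -> 0 <= t -> `|y s - y t| <= M * `|s - t| &
    forall s : R, 0 < s -> is_derive s 1 y (G s (y s))].
Proof.
move=> GM cG; have M0 : 0 <= M by exact: le_trans (normr_ge0 _) (GM 0 0).
have hn (n : nat) : 0 < n.+1%:R^-1 :> R by rewrite invr_gt0.
have step_le n (p q : R) : 0 <= p <= q ->
    `|euler_step G n q - euler_step G n p| <= (q - p + n.+1%:R^-1) * M.
  move=> pq; have := @euler_step_increment _ G n 0 M p q pq M0.
  rewrite mulr0 subr0 normr0 addr0 -mulrDl; apply => k _ _.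
  by rewrite subr0.
have step0 n (t : R) : t <= 0 -> euler_step G n t = 0.
  move=> t0; rewrite /euler_step; have [->|t1] := eqVneq t 0.
    by rewrite mul0r truncn0.
  suff -> : Num.truncn (t * n.+1%:R) = 0%N by [].
  apply/truncn0Pn; rewrite -ltNge (@lt_trans _ _ 0)// pmulr_llt0 ?ltr0n//.
  by rewrite lt_neqAle t1.
have stepB n t : `|euler_step G n t| <= (`|t| + 1) * M.
  have [t0|t0] := leP t 0; first by rewrite step0// normr0 mulr_ge0// addr_ge0.
  have := @step_le n 0 t; rewrite (step0 n 0)// !subr0 lexx (ltW t0) => /(_ isT) h.
  rewrite (le_trans h)// ler_wpM2r// gtr0_norm// lerD2l invf_le1 ?ltr0n//.
  by rewrite ler1n.
have [y yP] := pointwise_cluster stepB.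
have approx (s t eps : R) : 0 < eps -> exists n, [/\ n.+1%:R^-1 < eps,
    `|euler_step G n s - y s| < eps & `|euler_step G n t - y t| < eps].
  move=> eps0; have [n Nn [h1 h2]] := yP s t eps (Num.truncn eps^-1) eps0.
  exists n; split => //; rewrite invf_plt ?posrE ?ltr0n//.
  by rewrite (lt_le_trans (truncnS_gt _))// ler_nat ltnS.
have ylip0 (p q : R) : 0 <= p <= q -> `|y q - y p| <= M * (q - p).
  move=> pq; apply/ler_addgt0Pr => eps eps0.
  pose d : R := eps / (2 + M); have d0 : 0 < d by rewrite divr_gt0//; lra.
  have [n [n1 n2 n3]] := approx p q d d0.
  have n4 := step_le n p q pq.
  have n5 : n.+1%:R^-1 * M <= d * M by rewrite ler_wpM2r// ltW.
  have dE : d * (2 + M) = eps by rewrite divfK// gt_eqF//; lra.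
  move: n1 n2 n3 n4 n5 dE; move: (n.+1%:R^-1) => h; clearbody d.
  rewrite !ltr_norml !ler_norml => ? /andP[? ?] /andP[? ?] /andP[? ?] ? ?.
  by apply/andP; split; lra.
have ylip (s t : R) : 0 <= s -> 0 <= t -> `|y s - y t| <= M * `|s - t|.
  move=> s0 t0; have [st|st] := leP s t.
    by rewrite distrC [X in M * X]distrC (@ger0_norm _ (t - s)) ?ylip0 ?s0// subr_ge0.
  by rewrite (@gtr0_norm _ (s - t)) ?subr_gt0// ylip0// t0 ltW.
have y0 : y 0 = 0.
  apply/eqP; rewrite -normr_le0; apply/ler_addgt0Pr => eps eps0.
  have [n [_ + _]] := approx 0 0 eps eps0.
  by rewrite step0// sub0r normrN add0r => /ltW.
exists y; split => // s s0; apply/is_deriveP => e e0.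
have := cG (s, y s) => /cvgrPdist_le /(_ e e0) /nbhs_ballP[rho /= rho0 Hrho].
(* Let z be the tolerance chosen below and h < z the step. Grid points between p and q are within d
   + h of s, and their Euler values within (3 d + 2 h) M + z of y s; both are less than C (d + z) <=
   rho. *)
pose C := 2 + 3 * M; have C0 : 0 < C by rewrite /C; lra.
have rC : 0 < rho / C by rewrite divr_gt0.
pose d : R := Num.min s (rho / C) / 2.
have d0 : 0 < d by rewrite /d divr_gt0// lt_min s0.
have [ds dC] : d < s /\ d * C < rho.
  have ms : Num.min s (rho / C) <= s by rewrite ge_min lexx.
  have mr : Num.min s (rho / C) <= rho / C by rewrite ge_min lexx orbT.
  rewrite /d; set m := Num.min _ _ in ms mr *.
  split; first by clear - ms s0; lra.
  by rewrite -ltr_pdivlMr//; clear - mr rC; lra.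
have main (p q : R) : `|p - s| < d -> `|q - s| < d -> p <= q ->
    `|y q - y p - (q - p) * G s (y s)| <= e * (q - p).
  move=> ps qs pq; have p0 : 0 <= p by move: ps; rewrite ltr_norml; lra.
  apply/ler_addgt0Pr => eps eps0.
  pose c := 2 + e + `|G s (y s)|.
  have c0 : 0 < c by rewrite /c ltr_wpDr//; lra.
  have gap : 0 < (rho - d * C) / C by rewrite divr_gt0//; lra.
  pose z : R := Num.min (eps / c) ((rho - d * C) / C).
  have z0 : 0 < z by rewrite /z lt_min gap divr_gt0.
  have zc : z * c <= eps by rewrite -ler_pdivlMr// ge_min lexx.
  have zC : z * C <= rho - d * C by rewrite -ler_pdivlMr// ge_min lexx orbT.
  have [n [n1 n2 n3]] := approx p q z z0.
  have := @euler_step_increment _ G n (G s (y s)) e p q.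
  rewrite p0 pq => /(_ isT (ltW e0)).
  set h : R := n.+1%:R^-1 in n1 *; have h0 : 0 < h := hn n.
  have sle (p' q' : R) : 0 <= p' <= q' ->
      `|euler_step G n q' - euler_step G n p'| <= (q' - p' + h) * M.
    exact: step_le.
  have h1 : h * (e + `|G s (y s)|) <= z * (e + `|G s (y s)|).
    by rewrite ler_wpM2r ?addr_ge0 ?(ltW e0)// ltW.
  have hM : h * M <= z * M by rewrite ler_wpM2r// ltW.
  move=> H; have {}H : `|euler_step G n q - euler_step G n p -
      (q - p) * G s (y s)| <= (q - p) * e + h * (e + `|G s (y s)|).
    apply: H => k kp /andP[k1 k2]; rewrite distrC.
    have ak : euler_seq G h k = euler_step G n (k%:R * h).
      by rewrite /euler_step -mulrA mulVf ?mulr1 ?natrK ?gt_eqF ?ltr0n.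
    have kh0 : 0 <= k%:R * h by rewrite mulr_ge0 ?ler0n// ltW.
    have h2 : `|euler_seq G h k - euler_step G n p| <= (2 * d + 2 * h) * M.
      move: (ps) (qs); rewrite !ltr_norml => /andP[p1 p2] /andP[q1 q2].
      have [pk|kltp] := leP p (k%:R * h).
        rewrite ak (le_trans (sle p _ _)) ?p0//.
        by rewrite ler_wpM2r//; lra.
      rewrite distrC ak (le_trans (sle (k%:R * h) p _))//.
        by rewrite kh0 ltW.
      by rewrite ler_wpM2r//; lra.
    have yps : `|y p - y s| <= M * d.
      by rewrite (le_trans (ylip p s p0 (ltW s0)))// ler_wpM2l// ltW.
    apply: (Hrho (k%:R * h, euler_seq G h k)); split; rewrite /ball /= distrC.
      by move: ps qs; rewrite !ltr_norml /C in zC * => /andP[? ?] /andP[? ?]; nra.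
    rewrite -(subrK (euler_step G n p) (euler_seq G h k)) -addrA.
    rewrite (le_lt_trans (ler_normD _ _))//.
    have -> : euler_step G n p - y s = (euler_step G n p - y p) + (y p - y s).
      by rewrite addrA subrK.
    have := ler_normD (euler_step G n p - y p) (y p - y s).
    have zM : 0 <= z * M by rewrite mulr_ge0// ltW.
    by rewrite /C in zC *; lra.
  move: n2 n3 H; rewrite !ltr_norml !ler_norml => /andP[? ?] /andP[? ?] /andP[? ?].
  by rewrite /c in zc; lra.
exists d => // v vs.
have ss : `|s - s| < d by rewrite subrr normr0.
have [sv|sv] := leP s v.
  by rewrite [X in e * X]ger0_norm ?subr_ge0// [_ * (v - s)]mulrC main.
rewrite [X in e * X]ltr0_norm ?subr_lt0// opprB -normrN.
have -> : - (y v - y s - G s (y s) * (v - s)) =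
  y s - y v - (s - v) * G s (y s) by ring.
by rewrite main// ltW.
Qed.

(** * Solutions *)

(** Composition with this retraction extends functions continuous within [0, 1] to continuous
    functions on the line. *)
Definition clamp01 (R : realType) (x : R) : R := Num.max 0 (Num.min x 1).

Lemma clamp01_itv (R : realType) (x : R) : 0 <= clamp01 x <= 1.
Proof. by rewrite /clamp01 le_max lexx ge_max ler01 ge_min lexx orbT. Qed.

Lemma clamp01_id (R : realType) (x : R) : 0 <= x <= 1 -> clamp01 x = x.
Proof. by move=> /andP[x0 x1]; rewrite /clamp01 min_l// max_r. Qed.

Lemma continuous_clamp01 (R : realType) (h : R -> R) :
  {within `[0, 1]%classic, continuous h} ->
  continuous (fun x => h (clamp01 x)).
Proof.
move=> /subspace_continuousP ch x.
have cc : clamp01 y @[y --> x] --> clamp01 x.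
  have cm : {for x, continuous ((id : R -> R) \min cst 1)}.
    by apply: continuous_min; [exact: cvg_id|exact: cvg_cst].
  have c0 : {for x, continuous (cst 0 : R -> R)} by exact: cvg_cst.
  exact: (continuous_max c0 cm).
apply: (@cvg_comp _ _ _ (@clamp01 R) h _
  (within `[0, 1]%classic (nbhs (clamp01 x)))).
  move=> A; rewrite /within /= => hA.
  have : nbhs x [set y | `[0, 1]%classic (clamp01 y) -> A (clamp01 y)] := cc _ hA.
  by apply: filterS => y /=; apply; rewrite in_itv/= clamp01_itv.
by apply: ch; rewrite /= in_itv/= clamp01_itv.
Qed.

Lemma within_clamp01 (R : realType) (h k : R -> R) : continuous k ->
  (forall x : R, 0 <= x <= 1 -> h x = k x) ->
  {within `[0, 1]%classic, continuous h}.
Proof.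
move=> ck hk; apply: (@subspace_eq_continuous _ _ _ k); last first.
  exact: continuous_subspaceT.
by move=> x; rewrite inE /= in_itv/= => /hk/esym.
Qed.

Lemma bounded01 (R : realType) (h : R -> R) :
  {within `[0, 1]%classic, continuous h} ->
  exists2 B : R, 0 < B & forall x : R, 0 <= x <= 1 -> `|h x| <= B.
Proof.
move=> ch.
have [c _ cM] := @EVT_max _ h 0 1 ler01 ch.
have [d _ dm] := @EVT_min _ h 0 1 ler01 ch.
exists (`|h c| + `|h d| + 1) => [|x x01].
  by rewrite ltr_wpDl// addr_ge0.
have := cM x; have := dm x; rewrite in_itv/= x01 => /(_ isT) h1 /(_ isT) h2.
have := ler_norm (h c); have := ler_norm (- h d); rewrite normrN.
have := normr_ge0 (h c); have := normr_ge0 (h d).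
by rewrite ler_norml; lra.
Qed.

Lemma is_derive_increment (R : realType) (w z : R -> R) (u l d : R) :
  0 < d -> (forall v, `|v - u| < d -> w v - w u = z v - z u) ->
  is_derive u 1 z l -> is_derive u 1 w l.
Proof.
move=> d0 wz /is_deriveP H; apply/is_deriveP => e e0.
have [k k0 kH] := H e e0; exists (Num.min d k); first by rewrite lt_min d0.
by move=> v; rewrite lt_min => /andP[vd vk]; rewrite wz// kH.
Qed.

Definition ode_rhs (R : realType) (f phi E : R -> R) (sigma u r : R) : R :=
  2 * sigma * Num.sqrt r - 2 * f u * ratio_g phi (E u) r.

(* The classical formulation, equivalent to [caratheodory_sol] since the right
   hand side is continuous. *)
Definition ode_sol (R : realType) (f phi E : R -> R) (sigma : R) (r : R -> R) :=
  [/\ {within `[0, 1]%classic, continuous r}, r 1 = 0 &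
      forall u : R, 0 < u < 1 ->
        is_derive u 1 r (ode_rhs f phi E sigma u (r u))].

Section Solutions.
Context {R : realType} {f phi E : R -> R} {sigma : R}.
Hypotheses (hf : reaction f) (hphi : flux_limiter phi).
Hypothesis cE : {within `[0, 1]%classic, continuous E}.
Hypothesis E_ge0 : forall u : R, 0 <= u <= 1 -> 0 <= E u.
Hypothesis cf : {within `[0, 1]%classic, continuous f}.

Lemma ode_rhs_cvg (T : Type) (F : set_system T) (FF : Filter F) (c r : T -> R)
    (c0 r0 : R) :
  c y @[y --> F] --> c0 -> r y @[y --> F] --> r0 ->
  ode_rhs f phi E sigma (clamp01 (c y)) (r y) @[y --> F] -->
  ode_rhs f phi E sigma (clamp01 c0) r0.
Proof.
move=> cc cr.
have cfc : f (clamp01 (c y)) @[y --> F] --> f (clamp01 c0).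
  exact: (cvg_comp _ _ cc (@continuous_clamp01 R f cf c0)).
have cEc : E (clamp01 (c y)) @[y --> F] --> E (clamp01 c0).
  exact: (cvg_comp _ _ cc (@continuous_clamp01 R E cE c0)).
apply: cvgB.
  apply: cvgMr; exact: continuous_cvg (@sqrt_continuous R _) cr.
apply: cvgM; first exact: cvgMr.
apply: (ratio_g_cvg hphi) => //.
- by move=> y; rewrite E_ge0// clamp01_itv.
- by rewrite E_ge0// clamp01_itv.
Qed.

Lemma ode_rhs_continuous (r : R -> R) :
  {within `[0, 1]%classic, continuous r} ->
  exists2 k : R -> R, continuous k & forall u : R, 0 <= u <= 1 ->
    k u = ode_rhs f phi E sigma u (r u) /\
    k u = Phi_e f phi E sigma u (r u).
Proof.
move=> cr.
exists (fun u => ode_rhs f phi E sigma (clamp01 u) (r (clamp01 u))).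
  move=> u; apply: (@ode_rhs_cvg _ _ _ (fun u => u) (fun u => r (clamp01 u))).
    exact: cvg_id.
  exact: continuous_clamp01.
by move=> u u01; rewrite clamp01_id// Phi_eE ?E_ge0.
Qed.

Lemma caratheodory_ode_sol (r : R -> R) :
  caratheodory_sol f phi E sigma r -> ode_sol f phi E sigma r.
Proof.
move=> [cr _ rE]; have [k ck kE] := ode_rhs_continuous cr.
have ik (a b : R) : (@lebesgue_measure R).-integrable `[a, b] (EFin \o k).
  apply: continuous_compact_integrable; first exact: segment_compact.
  exact: continuous_subspaceT.
have rk u : 0 <= u <= 1 -> r u = - \int[@lebesgue_measure R]_(t in `[u, 1]) k t.
  move=> /andP[u0 u1]; rewrite rE ?u0//; congr -%R; apply: eq_Rintegral => t.
  rewrite inE/= in_itv/= => /andP[ut t1].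
  by have [|_ ->] := kE t; rewrite ?t1 ?(le_trans u0).
split => //.
  by rewrite rk ?ler01 ?lexx// set_itv1 Rintegral_set1 oppr0.
move=> u /andP[u0 u1].
(* The fundamental theorem differentiates in the upper limit, so minus the integral over [u, 1] is
   rewritten as F u - F 1. *)
pose F x := \int[@lebesgue_measure R]_(t in `[0, x]) k t.
have rF v : 0 <= v <= 1 -> r v = F v - F 1.
  move=> /andP[v0 v1]; rewrite rk ?v0// /F.
  have iv : (@lebesgue_measure R).-integrable `]v, 1] (EFin \o k).
    apply: (@integrableS _ _ _ (@lebesgue_measure R) `[v, 1]%classic) (ik v 1) => //.
    by apply: subset_itvr; rewrite bnd_simp.
  rewrite -(Rintegral_itv_obnd_cbnd iv) -(Rintegral_itvB (ik 0 1)) ?bnd_simp//.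
  by rewrite opprB.
have [dF FE] := @continuous_FTC1_closed R k 0 u 1 u1 (ik 0 1) u0 (ck u).
have [|<- _] := kE u; first by rewrite !ltW.
pose d := Num.min u (1 - u).
apply: (@is_derive_increment _ r F u (k u) d).
- by rewrite lt_min u0 subr_gt0.
- move=> v; rewrite /d lt_min !ltr_norml => /andP[/andP[? ?] /andP[? ?]].
  by rewrite !rF; lra.
by rewrite -FE derive1E; exact: DeriveDef.
Qed.

Lemma ode_caratheodory_sol (r : R -> R) :
  ode_sol f phi E sigma r -> caratheodory_sol f phi E sigma r.
Proof.
move=> [cr r1 dr]; have [k ck kE] := ode_rhs_continuous cr.
have ck01 (a b : R) : {within `[a, b], continuous k}.
  exact: continuous_subspaceT.
split => //.
  apply: continuous_compact_integrable; first exact: segment_compact.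
  by apply: (within_clamp01 ck) => x /kE[_ ->].
move=> u /andP[u0 u1].
transitivity (- \int[@lebesgue_measure R]_(t in `[u, 1]) k t); last first.
  congr -%R; apply: eq_Rintegral => t; rewrite inE/= in_itv/= => /andP[ut t1].
  by have [|_ ->] := kE t; rewrite ?t1 ?(le_trans u0).
have [->|u_neq1] := eqVneq u 1.
  by rewrite set_itv1 Rintegral_set1 oppr0.
have u_lt1 : u < 1 by rewrite lt_neqAle u_neq1.
rewrite /Rintegral (@continuous_FTC2 _ k r)//=.
- by rewrite r1; lra.
- have cru : {within `[u, 1], continuous r} by exact: within_subspace cr.
  have [/(_ cru)[cr1 cr2 cr3] _] := continuous_within_itvP r u_lt1.
  split => // x; rewrite in_itv/= => /andP[ux x1].
  have /dr [] // : 0 < x < 1 by rewrite x1 (le_lt_trans u0).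
move=> x; rewrite in_itv/= => /andP[ux x1].
have x01 : 0 < x < 1 by rewrite x1 (le_lt_trans u0).
have [|-> _] := kE x; first by have /andP[/ltW -> /ltW ->] := x01.
by have := dr x x01; rewrite derive1E => -[_ ->].
Qed.

Lemma f_ge0 (u : R) : 0 <= u <= 1 -> 0 <= f u.
Proof.
have [_ f0 f1 fp] := hf; move=> /andP[].
rewrite le_eqVlt => /predU1P[<- _|u0]; first by rewrite f0.
rewrite le_eqVlt => /predU1P[->|u1]; first by rewrite f1.
by rewrite ltW// fp// u0.
Qed.

(** Peano's theorem is run backwards from u = 1 in the variable s = 1 - u, with r cut off at [B], a
    bound of the source term, to make the right hand side bounded. The cut-off is inactive: r' >= -
    B and r 1 = 0 give r <= B. *)
Lemma ode_sol_exists : 0 <= sigma -> exists r, ode_sol f phi E sigma r.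
Proof.
move=> s0.
have [M M0 hM] := ratio_g_bounds hphi.
have [Bf Bf0 hBf] := bounded01 cf; have [BE BE0 hBE] := bounded01 cE.
pose B := 2 * Bf * (M * BE).
have B0 : 0 < B by rewrite !mulr_gt0.
have ratio_le x y : 0 <= ratio_g phi (E (clamp01 x)) y <= M * BE.
  have /andP[-> h] := hM (E (clamp01 x)) y (E_ge0 (clamp01_itv x)).
  rewrite (le_trans h)// ler_pM2l// (le_trans (ler_norm _))// hBE//.
  exact: clamp01_itv.
have src_le x y : 0 <= 2 * f (clamp01 x) * ratio_g phi (E (clamp01 x)) y <= B.
  have /andP[h1 h2] := ratio_le x y.
  have h3 := f_ge0 (clamp01_itv x); have h4 := hBf _ (clamp01_itv x).
  rewrite !mulr_ge0//= /B ler_pM ?mulr_ge0// ler_pM2l//.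
  exact: le_trans (ler_norm _) h4.
pose G s y := - ode_rhs f phi E sigma (clamp01 (1 - s)) (Num.min y B).
have GM s y : `|G s y| <= 2 * sigma * Num.sqrt B + B.
  rewrite /G /ode_rhs normrN (le_trans (ler_normB _ _))// lerD//.
    rewrite ger0_norm ?mulr_ge0 ?sqrtr_ge0// ler_wpM2l ?mulr_ge0//.
    by rewrite ler_sqrt ?ge_min ?lexx ?orbT// ltW.
  by have /andP[h1 h2] := src_le (1 - s) (Num.min y B); rewrite ger0_norm.
have cG : continuous (fun p : R * R => G p.1 p.2).
  move=> p; rewrite /G; apply: cvgN.
  apply: (@ode_rhs_cvg _ _ _ (fun p : R * R => 1 - p.1)
           (fun p : R * R => Num.min p.2 B)).
    by apply: cvgB; [exact: cvg_cst|exact: cvg_fst].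
  have c2 : {for p, continuous (snd : R * R -> R)} by exact: cvg_snd.
  have cB : {for p, continuous (cst B : R * R -> R)} by exact: cvg_cst.
  exact: (continuous_min c2 cB).
have [y [y0 ylip yd]] := peano GM cG.
pose r u := y (1 - u).
have cr : {within `[0, 1]%classic, continuous r}.
  apply/subspace_continuousP => x /=; rewrite in_itv/= => x01.
  set K := _ + B in ylip.
  have K0 : 0 < K by rewrite /K ltr_wpDl// mulr_ge0 ?sqrtr_ge0// mulr_ge0.
  apply/cvgrPdist_le => e e0; rewrite near_withinE.
  apply/nbhs_ballP; exists (e / K); first by rewrite /= divr_gt0.
  move=> z; rewrite /ball /= in_itv/= => zx z01.
  rewrite /r (le_trans (ylip _ _ _ _)) ?subr_ge0//; [lra|lra|].
  rewrite (_ : 1 - x - (1 - z) = z - x); last ring.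
  by rewrite distrC -ler_pdivlMl// mulrC ltW.
have dr (u : R) : 0 < u < 1 -> is_derive u 1 r (ode_rhs f phi E sigma u (Num.min (r u) B)).
  move=> u01; have := yd (1 - u); rewrite subr_gt0.
  have /andP[u0 u1] := u01; move=> /(_ u1) /is_deriveP H.
  apply/is_deriveP => e e0; have [d d0 Hd] := H e e0; exists d => // v vd.
  have -> : `|v - u| = `|(1 - v) - (1 - u)| by rewrite distrC; congr `|_|; ring.
  have -> : r v - r u - ode_rhs f phi E sigma u (Num.min (r u) B) * (v - u) =
     y (1 - v) - y (1 - u) - G (1 - u) (y (1 - u)) * (1 - v - (1 - u)).
    by rewrite /G subKr clamp01_id ?ltW// /r; ring.
  apply: Hd; rewrite (_ : _ - _ = - (v - u)) ?normrN//; ring.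
have r_le (u : R) : 0 < u < 1 -> r u <= B.
  move=> /andP[u0 u1].
  have [||c] := @MVT _ r (fun u => ode_rhs f phi E sigma u (Num.min (r u) B)) u 1 u1.
  - by move=> x; rewrite in_itv/= => /andP[ux x1]; apply: dr; lra.
  - by apply: within_subspace cr; lra.
  rewrite in_itv/= {1}/r subrr y0 /ode_rhs => cu h.
  have := src_le c (Num.min (r c) B); rewrite clamp01_id; last lra.
  have : 0 <= 2 * sigma * Num.sqrt (Num.min (r c) B).
    by rewrite !mulr_ge0 ?sqrtr_ge0.
  by move=> h1 /andP[h2 h3]; nra.
exists r; split => //; first by rewrite /r subrr.
by move=> u u01; have := dr u u01; rewrite min_l// r_le.
Qed.

Lemma Rsol_ode_sol : 0 <= sigma -> ode_sol f phi E sigma (Rsol f phi E sigma).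
Proof.
move=> s0; apply: caratheodory_ode_sol; rewrite /Rsol.
have [r /ode_caratheodory_sol rP] := ode_sol_exists s0.
by case: xgetP => [? _ //|/(_ r)].
Qed.

End Solutions.

(** * Comparison of solutions *)

Lemma is_derive_addM (R : realType) (w : R -> R) (u l a : R) :
  is_derive u 1 w l -> is_derive u 1 (fun x => w x + a * x) (l + a).
Proof.
move=> /is_deriveP H; apply/is_deriveP => e /H[d d0 Hd]; exists d => // v vd.
rewrite (_ : _ - _ - _ = w v - w u - l * (v - u)); last ring.
exact: Hd.
Qed.

Lemma within_continuousD (R : realType) (w z : R -> R) (A : set R) :
  {within A, continuous w} -> {within A, continuous z} ->
  {within A, continuous (fun x => w x + z x)}.
Proof. by move=> cw cz x; apply: cvgD; [exact: cw|exact: cz]. Qed.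

Lemma within_continuous_mull (R : realType) (A : set R) (a : R) :
  {within A, continuous (fun x => a * x)}.
Proof.
by apply: continuous_subspaceT => x; apply: cvgM; [exact: cvg_cst|exact: cvg_id].
Qed.

Lemma within_continuous_sqrt (R : realType) (w : R -> R) (A : set R) :
  {within A, continuous w} ->
  {within A, continuous (fun x => Num.sqrt (w x))}.
Proof.
by move=> cw x; exact: continuous_cvg (@sqrt_continuous R _) (cw x).
Qed.

Lemma ratio_g_le0 (R : realType) (phi : R -> R) (E r : R) : r <= 0 ->
  ratio_g phi E r = E * derive1 phi 0.
Proof. by rewrite leNgt /ratio_g => /negbTE ->. Qed.

Lemma recip_g_eq0 (R : realType) (phi : R -> R) (E v : R) : E <= v ->
  recip_g phi E v = 0.
Proof. by rewrite /recip_g => ->. Qed.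

Section OneSolution.
Context {R : realType} {f phi E : R -> R} {sigma : R} {r : R -> R}.
Hypotheses (hf : reaction f) (hphi : flux_limiter phi).
Hypothesis E_ge0 : forall u : R, 0 <= u <= 1 -> 0 <= E u.
Hypothesis sol : ode_sol f phi E sigma r.

Lemma ode_sol_within (b c : R) : 0 <= b -> c <= 1 ->
  {within `[b, c], continuous r}.
Proof. by have [cr _ _] := sol; move=> b0 c1; exact: within_subspace cr. Qed.

(** Where r <= 0 one has r' = - 2 f E phi'(0) <= 0, so a negative value would persist up to u =
    1. *)
Lemma ode_sol_ge0 (u : R) : 0 <= u <= 1 -> 0 <= r u.
Proof.
move=> /andP[u0 u1]; have [_ r1 dr] := sol.
have [_ _ _ dp _] := hphi.
suff : - r u <= Num.max 0 (- r 1) by rewrite r1 oppr0 maxxx; lra.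
apply: (@right_dini_le _ (fun x => - r x)) => //.
  by move=> x; apply: cvgN; apply: ode_sol_within.
move=> x /andP[ux x1] rx e e0.
have x01 : 0 < x < 1 by rewrite x1 (le_lt_trans u0).
have rx0 : r x <= 0 by lra.
have : is_derive x 1 (fun y => - r y) (- ode_rhs f phi E sigma x (r x)).
  by apply: is_deriveN; exact: dr.
move=> /is_derive_right_gt -/(_ (- e) 1); rewrite /ode_rhs ler0_sqrtr//.
rewrite ratio_g_le0// mulr0 sub0r opprK => -[||v vx hv].
- rewrite (@lt_le_trans _ _ 0) ?oppr_lt0// !mulr_ge0//.
  + by apply: f_ge0 => //; rewrite !ltW//; have /andP[] := x01.
  + by apply: E_ge0; have /andP[/ltW -> /ltW ->] := x01.
  + exact: ltW.
- by [].
by exists v => //; rewrite mulNr in hv.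
Qed.

Lemma is_derive_sqrt_sol (u : R) : 0 < u < 1 -> 0 < r u ->
  is_derive u 1 (fun x => Num.sqrt (r x))
    (sigma - f u * recip_g phi (E u) (Num.sqrt (r u))).
Proof.
move=> u01 ru; have [_ _ /(_ u u01) dr] := sol.
have := @is_derive1_comp _ Num.sqrt r u _ _ (is_derive1_sqrt ru) dr.
have s0 : Num.sqrt (r u) != 0 by rewrite gt_eqF// sqrtr_gt0.
rewrite /ode_rhs /ratio_g ru.
rewrite (_ : _ * _ = sigma - f u * recip_g phi (E u) (Num.sqrt (r u)))//.
by field.
Qed.

(** V' <= sigma wherever V > 0. At zeros V may fail to be differentiable, but [left_increase_le]
    only concerns points where V exceeds V b plus a nonnegative term. The slack [k] makes the slope
    inequality strict. *)
Lemma sqrt_sol_lip (b c : R) : 0 <= sigma -> 0 <= b <= c -> c < 1 ->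
  Num.sqrt (r c) - Num.sqrt (r b) <= sigma * (c - b).
Proof.
move=> s0 /andP[b0 bc] c1; apply/ler_addgt0Pr => e e0.
pose k := e / (c - b + 1).
have k0 : 0 < k by rewrite divr_gt0//; lra.
have kE : k * (c - b + 1) = e by rewrite divfK// gt_eqF//; lra.
have kcb : 0 <= k * (c - b) by rewrite mulr_ge0 ?(ltW k0) ?subr_ge0.
suff : Num.sqrt (r c) + (- (sigma + k)) * c <=
    Num.sqrt (r b) + (- (sigma + k)) * b by clearbody k; lra.
apply: (@left_increase_le _ (fun x => Num.sqrt (r x) + (- (sigma + k)) * x)) => //.
  apply: within_continuousD; last exact: within_continuous_mull.
  by apply: within_continuous_sqrt; apply: ode_sol_within => //; exact: ltW.
move=> u /andP[bu uc] qu.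
have sku : 0 <= (sigma + k) * (u - b) by rewrite mulr_ge0; clearbody k; lra.
have ru : 0 < r u.
  rewrite -sqrtr_gt0; have := sqrtr_ge0 (r b); clearbody k; lra.
have u01 : 0 < u < 1 by lra.
have /(@is_derive_addM _ _ _ _ (- (sigma + k))) := is_derive_sqrt_sol u01 ru.
move=> /is_derive_left_gt -/(_ 0 b) [||v vu hv] //.
  have : 0 <= f u * recip_g phi (E u) (Num.sqrt (r u)).
    rewrite mulr_ge0// ?(recip_g_ge0 hphi) ?sqrtr_gt0//.
    by apply: (f_ge0 hf); lra.
  by clearbody k; lra.
by exists v => //; rewrite mul0r addr0 in hv.
Qed.

End OneSolution.

(** Where w = V1 - V2 - d (c - x) is positive, V1 > V2, and if V2 > 0 monotonicity of 1 / g gives w'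
    >= sigma1 - sigma2 + d >= 0, as [right_dini_le] requires. *)
Lemma sol_comparison (R : realType) (f phi E1 E2 r1 r2 : R -> R)
    (sigma1 sigma2 d b c : R) : reaction f -> flux_limiter phi ->
  (forall u : R, 0 <= u <= 1 -> 0 <= E1 u) ->
  (forall u : R, 0 <= u <= 1 -> 0 <= E2 u) ->
  ode_sol f phi E1 sigma1 r1 -> ode_sol f phi E2 sigma2 r2 ->
  0 <= sigma2 -> 0 <= d -> sigma2 - sigma1 <= d ->
  0 <= b -> b <= c -> c <= 1 -> (forall u, b < u < c -> E1 u <= E2 u) ->
  Num.sqrt (r1 b) - Num.sqrt (r2 b) - d * (c - b) <=
  Num.max 0 (Num.sqrt (r1 c) - Num.sqrt (r2 c)).
Proof.
move=> hf hphi E1_ge0 E2_ge0 sol1 sol2 s2_ge0 d0 sd b0 bc c1 E12.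
have [_ _ _ dp _] := hphi.
pose w x := (Num.sqrt (r1 x) - Num.sqrt (r2 x)) - d * c + d * x.
have -> : Num.sqrt (r1 b) - Num.sqrt (r2 b) - d * (c - b) = w b.
  by rewrite /w; ring.
have -> : Num.sqrt (r1 c) - Num.sqrt (r2 c) = w c by rewrite /w; ring.
apply: right_dini_le => //.
  apply: within_continuousD; last exact: within_continuous_mull.
  apply: within_continuousD; last first.
    by apply: continuous_subspaceT => x; exact: cvg_cst.
  apply: within_continuousD.
    by apply: within_continuous_sqrt; exact: (ode_sol_within sol1).
  move=> x; apply: cvgN.
  by apply: within_continuous_sqrt; exact: (ode_sol_within sol2).
move=> u /andP[bu uc] wu e e0.
have u01 : 0 < u < 1 by lra.
have u01' : 0 <= u <= 1 by lra.
have fu : 0 < f u by have [_ _ _ ->] := hf.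
have dcu : 0 <= d * (c - u) by rewrite mulr_ge0//; lra.
have s20 := sqrtr_ge0 (r2 u).
have s12 : Num.sqrt (r2 u) < Num.sqrt (r1 u) by rewrite /w in wu; lra.
have r1u : 0 < r1 u by rewrite -sqrtr_gt0; lra.
have D1 := is_derive_sqrt_sol sol1 u01 r1u.
have [r2u|r2u] := ltP 0 (r2 u).
  have D2 := is_derive_sqrt_sol sol2 u01 r2u.
  have : is_derive u 1 (fun x => Num.sqrt (r1 x) - Num.sqrt (r2 x)) _ :=
    is_deriveB D1 D2.
  move=> /is_derive_right_gt -/(_ (- d - e) c); case=> //.
    have : f u * recip_g phi (E1 u) (Num.sqrt (r1 u)) <=
        f u * recip_g phi (E2 u) (Num.sqrt (r2 u)).
      rewrite ler_pM2l//; apply: (le_recip_g hphi).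
        by rewrite E1_ge0// E12// bu.
      by rewrite sqrtr_gt0 r2u ltW.
    lra.
  by move=> v vu hv; exists v => //; rewrite /w; lra.
(* At an interior zero of r2, E2 u > 0 would give r2' < 0 and negative values just to the right. So
   E2 u = E1 u = 0, whence V1' = sigma1, while V2 grows at rate at most sigma2. *)
have r2u0 : r2 u = 0.
  by apply/eqP; rewrite eq_le r2u (ode_sol_ge0 hf hphi E2_ge0 sol2 u01').
have E2u : E2 u = 0.
  apply/eqP; rewrite eq_le E2_ge0// andbT leNgt; apply/negP => E2u.
  have [_ _ /(_ u u01) dr2] := sol2.
  have : is_derive u 1 (fun x => - r2 x) (- ode_rhs f phi E2 sigma2 u (r2 u)).
    exact: is_deriveN.
  move=> /is_derive_right_gt -/(_ 0 c); case=> //.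
    rewrite /ode_rhs r2u0 sqrtr0 ratio_g_le0// mulr0 sub0r opprK.
    by rewrite !mulr_gt0.
  move=> v uv; rewrite r2u0 mul0r.
  by have := ode_sol_ge0 hf hphi E2_ge0 sol2 (u := v); lra.
have E1u : E1 u = 0.
  by apply/eqP; rewrite eq_le E1_ge0// andbT -E2u E12// bu.
move: D1; rewrite E1u recip_g_eq0 ?sqrtr_ge0// mulr0 subr0.
move=> /is_derive_right_gt -/(_ (sigma1 - e) c); case=> //; first lra.
move=> v uv hv; exists v => //.
have := sqrt_sol_lip hf hphi sol2 (b := u) (c := v) s2_ge0.
rewrite /w r2u0 sqrtr0 => /(_ ltac:(lra) ltac:(lra)) h.
have : (sigma2 - sigma1) * (v - u) <= d * (v - u) by rewrite ler_wpM2r//; lra.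
lra.
Qed.

Lemma sol_le (R : realType) (f phi E1 E2 r1 r2 : R -> R)
    (sigma1 sigma2 b c : R) : reaction f -> flux_limiter phi ->
  (forall u : R, 0 <= u <= 1 -> 0 <= E1 u) ->
  (forall u : R, 0 <= u <= 1 -> 0 <= E2 u) ->
  ode_sol f phi E1 sigma1 r1 -> ode_sol f phi E2 sigma2 r2 ->
  0 <= sigma2 <= sigma1 -> 0 <= b -> b <= c -> c <= 1 ->
  (forall u, b < u < c -> E1 u <= E2 u) ->
  Num.sqrt (r1 c) <= Num.sqrt (r2 c) -> Num.sqrt (r1 b) <= Num.sqrt (r2 b).
Proof.
move=> hf hphi E1_ge0 E2_ge0 sol1 sol2 /andP[s20 s21] b0 bc c1 E12 Vc.
have s21' : sigma2 - sigma1 <= 0 by rewrite subr_le0.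
have := sol_comparison hf hphi E1_ge0 E2_ge0 sol1 sol2 s20 (lexx 0) s21' b0 bc
  c1 E12.
by rewrite mul0r subr0 max_l ?subr_le0.
Qed.

Lemma sol_le_speed (R : realType) (f phi E r1 r2 : R -> R)
    (sigma1 sigma2 : R) : reaction f -> flux_limiter phi ->
  (forall u : R, 0 <= u <= 1 -> 0 <= E u) ->
  ode_sol f phi E sigma1 r1 -> ode_sol f phi E sigma2 r2 ->
  0 <= sigma1 <= sigma2 ->
  Num.sqrt (r1 0) <= Num.sqrt (r2 0) + (sigma2 - sigma1).
Proof.
move=> hf hphi E_ge0 sol1 sol2 /andP[s10 s12].
have s20 := le_trans s10 s12.
have d0 : 0 <= sigma2 - sigma1 by rewrite subr_ge0.
have := sol_comparison hf hphi E_ge0 E_ge0 sol1 sol2 s20 d0 (lexx _) (lexx 0)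
  ler01 (lexx 1) (fun _ _ => lexx _).
have [_ -> _] := sol1; have [_ -> _] := sol2.
by rewrite subrr maxxx subr0 mulr1 => h; lra.
Qed.

(** * Functions of class C^1 and C^2 on [0, 1] *)

Lemma derivable01P (R : realType) (h : R -> R) (u : R) : derivable01 h u ->
  forall e : R, 0 < e -> exists2 d : R, 0 < d & forall v : R, 0 <= v <= 1 ->
    `|v - u| < d -> `|h v - h u - deriv01 h u * (v - u)| <= e * `|v - u|.
Proof.
rewrite /derivable01 -/(deriv01 h u) => H e e0.
move: H => /cvgrPdist_le /(_ e e0).
rewrite near_withinE /dnbhs near_withinE => /nbhs_ballP[d /= d0 Hd].
exists d => // v v01 vd.
have [->|vu] := eqVneq v u; first by rewrite !subrr mulr0 subrr normr0 mulr0.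
have vu0 : v - u != 0 by rewrite subr_eq0.
have := Hd v; rewrite /ball /= distrC vd => /(_ isT).
rewrite in_itv/= v01 /diffquot01 => h1.
have {h1} : `|deriv01 h u - (h v - h u) / (v - u)| <= e by exact: h1.
have -> : h v - h u - deriv01 h u * (v - u) =
    - ((deriv01 h u - (h v - h u) / (v - u)) * (v - u)) by field.
by rewrite normrN normrM => ?; rewrite ler_wpM2r.
Qed.

Lemma C1_01_continuous (R : realType) (h : R -> R) : C1_01 h ->
  {within `[0, 1]%classic, continuous h}.
Proof.
move=> [dh _]; apply/subspace_continuousP => x /=; rewrite in_itv/= => x01.
apply/cvgrPdist_le => e e0; rewrite near_withinE.
have [d d0 Hd] := derivable01P (dh x x01) ltr01.
pose k := `|deriv01 h x| + 1.
have k0 : 0 < k by rewrite ltr_wpDl.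
apply/nbhs_ballP; exists (Num.min d (e / k)); first by rewrite /= lt_min d0 divr_gt0.
move=> y; rewrite /ball /= lt_min distrC => /andP[yd ye]; rewrite in_itv/= => y01.
have := Hd y y01 yd; rewrite mul1r distrC => h1.
have h2 : `|y - x| * k <= e by rewrite -ler_pdivlMr// ltW.
rewrite -normrN opprB.
have -> : h y - h x = (h y - h x - deriv01 h x * (y - x)) + deriv01 h x * (y - x).
  by rewrite subrK.
rewrite (le_trans (ler_normD _ _))// normrM.
by rewrite distrC in h1; rewrite /k in h2; lra.
Qed.

Lemma is_derive_deriv01 (R : realType) (h : R -> R) (u : R) :
  derivable01 h u -> 0 < u < 1 -> is_derive u 1 h (deriv01 h u).
Proof.
move=> dh /andP[u0 u1]; apply/is_deriveP => e e0.
have [d d0 Hd] := derivable01P dh e0.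
exists (Num.min d (Num.min u (1 - u))); first by rewrite !lt_min d0 u0 subr_gt0.
move=> v; rewrite !lt_min => /andP[vd /andP[v1 v2]]; apply: Hd => //.
by move: v1 v2; rewrite !ltr_norml; lra.
Qed.

Lemma within_gt0_near (R : realType) (h : R -> R) (a : R) :
  {within `[0, 1]%classic, continuous h} -> 0 <= a <= 1 -> 0 < h a ->
  exists2 d : R, 0 < d & forall x, 0 <= x <= 1 -> `|x - a| < d -> 0 < h x.
Proof.
move=> /subspace_continuousP ch a01 ha.
have := ch a; rewrite /= in_itv/= => /(_ a01) /cvgrPdist_lt /(_ (h a) ha).
rewrite near_withinE => /nbhs_ballP[d /= d0 Hd]; exists d => // x x01 xa.
have := Hd x; rewrite /ball /= distrC in_itv/= => /(_ xa x01).
by rewrite /from_subspace ltr_norml; lra.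
Qed.

(** * Functions vanishing up to [u1] and strictly convex beyond it *)

Section FlatThenConvex.
Context {R : realType} {D : R -> R} {u1 : R}.
Hypotheses (u1_itv : 0 < u1 < 1) (D_C2 : C2_01 D).
Hypothesis D_flat : forall u : R, 0 <= u <= u1 -> D u = 0.
Hypothesis D_convex : forall u : R, u1 < u <= 1 -> 0 < deriv01 (deriv01 D) u.

Lemma flat_convex_MVT (x y : R) : 0 <= x < y -> y <= 1 ->
  exists2 z, x < z < y & D y - D x = deriv01 D z * (y - x).
Proof.
move=> /andP[x0 xy] y1; have [[dD _] _] := D_C2.
have [||z zxy E] := @MVT _ D (deriv01 D) x y xy.
- by move=> z; rewrite in_itv/= => zxy; apply: is_derive_deriv01; [apply: dD|]; lra.
- by apply: (within_subspace x0 y1); apply: C1_01_continuous; case: D_C2.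
by exists z.
Qed.

Lemma flat_convex_deriv_le (x y : R) : u1 <= x <= y -> y < 1 ->
  deriv01 D x <= deriv01 D y.
Proof.
move=> /andP[u1x]; rewrite le_eqVlt => /predU1P[->//|xy] y1.
have [_ [dD _]] := D_C2.
have /andP[u10 u11] := u1_itv; have x0 : 0 <= x by lra.
have [||z zxy E] := @MVT _ (deriv01 D) (deriv01 (deriv01 D)) x y xy.
- by move=> z; rewrite in_itv/= => zxy; apply: is_derive_deriv01; [apply: dD|]; lra.
- by apply: (within_subspace x0 (ltW y1)); apply: C1_01_continuous; case: D_C2.
have : 0 < deriv01 (deriv01 D) z * (y - x).
  by move: zxy; rewrite in_itv/= => zxy; rewrite mulr_gt0 ?D_convex//; lra.
lra.
Qed.

Lemma flat_convex_deriv0 : deriv01 D u1 = 0.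
Proof.
have [[dD _] _] := D_C2; have /andP[u10 u11] := u1_itv.
apply/eqP; rewrite -normr_le0; apply/ler_addgt0Pr => e e0; rewrite add0r.
have [|d d0 Hd] := @derivable01P _ D u1 _ e e0; first by apply: dD; lra.
pose m := Num.min d u1.
have m0 : 0 < m by rewrite lt_min d0.
have [md mu] : m <= d /\ m <= u1 by rewrite !ge_min !lexx orbT.
have := Hd (u1 - m / 2); rewrite !D_flat; [|lra|lra].
rewrite (_ : u1 - m / 2 - u1 = - (m / 2)); last ring.
rewrite normrN (@gtr0_norm _ (m / 2)); last lra.
rewrite subrr sub0r mulrN opprK normrM (@gtr0_norm _ (m / 2)); last lra.
by rewrite ler_pM2r; [apply; lra|lra].
Qed.

Lemma flat_convex_ge0 (x : R) : 0 <= x <= 1 -> 0 <= D x.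
Proof.
move=> /andP[x0 x1]; have [xu|ux] := leP x u1; first by rewrite D_flat ?x0.
have /andP[u10 u11] := u1_itv.
have [||z zu] := @flat_convex_MVT u1 x; [lra|by []|].
rewrite (D_flat (u := u1)) ?subr0 => [->|]; last lra.
rewrite mulr_ge0//; last lra.
by rewrite -flat_convex_deriv0 flat_convex_deriv_le//; lra.
Qed.

(** A point above the line would force a mean slope above s on [u1, x] and below s on [x, a],
    against the monotonicity of D'. *)
Lemma flat_convex_chord (u2 a s x : R) : 0 <= u2 <= u1 -> a < 1 -> 0 <= s ->
  D a <= s * (a - u2) -> u2 <= x <= a -> D x <= s * (x - u2).
Proof.
move=> u21 a1 s0 Da /andP[u2x xa]; have /andP[u10 u11] := u1_itv.
have [xu|ux] := leP x u1.
  by rewrite D_flat; [rewrite mulr_ge0//; lra|lra].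
move: xa; rewrite le_eqVlt => /predU1P[->//|xa].
rewrite leNgt; apply/negP => h.
have [||z1 z1u] := @flat_convex_MVT u1 x; [lra|lra|].
rewrite (D_flat (u := u1)) ?subr0 => [E1|]; last lra.
have [||z2 z2u E2] := @flat_convex_MVT x a; [lra|lra|].
have h1 : s < deriv01 D z1.
  rewrite -(@ltr_pM2r _ (x - u1)); last lra.
  rewrite -E1; apply: le_lt_trans h; rewrite ler_wpM2l//; lra.
have h2 : deriv01 D z2 < s.
  by rewrite -(@ltr_pM2r _ (a - x)); lra.
have := @flat_convex_deriv_le z1 z2; lra.
Qed.

End FlatThenConvex.

(* Where [E] is large, a solution bounded by [smax] has [r' <= - C E] with
   [C > 0], hence must leave the range that is compatible with [r 0 = 0]. *)
Lemma sol_gt0_of_large_flux (R : realType) (f phi : R -> R) (p q smax : R) :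
  reaction f -> flux_limiter phi -> 0 < p -> p < q -> q < 1 -> 0 < smax ->
  exists2 L : R, 0 < L & forall (E : R -> R) (sigma : R) (r : R -> R),
    (forall u : R, 0 <= u <= 1 -> 0 <= E u) ->
    (forall u : R, p < u < q -> L <= E u) ->
    0 < sigma <= smax -> ode_sol f phi E sigma r -> 0 < Num.sqrt (r 0).
Proof.
move=> hf hphi p0 pq q1 S0.
have [M [c0 [c0_gt0 /andP[c0d _] _ phic]]] := phi_bounds hphi.
have [fC1 _ _ fp] := hf.
have [|t tpq tmin] := @EVT_min _ f p q (ltW pq).
  apply: within_subspace (C1_01_continuous fC1); lra.
pose m := f t.
have m0 : 0 < m by apply: fp; move: tpq; rewrite in_itv/=; lra.
have phi1 : 0 < phi 1 by rewrite (phi_gt0 hphi).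
(* [L1] ensures sqrt r < E phi(1), so that g < 1 and the bound phi(s) >= c0 s applies. [L3] then
   forces r' <= - L2, and [L2] makes r drop by more than smax^2 across [p, q]. *)
pose L1 := smax / phi 1.
pose L2 := (smax ^+ 2 + 1) / (q - p).
pose L3 := (2 * smax ^+ 2 + L2) / (2 * m * c0).
have L10 : 0 < L1 by rewrite divr_gt0.
have L20 : 0 < L2 by rewrite divr_gt0 ?subr_gt0// ltr_wpDl// sqr_ge0.
have L30 : 0 < L3.
  by rewrite divr_gt0 ?mulr_gt0// ltr_wpDl// mulr_ge0// sqr_ge0.
exists (L1 + L3 + 1) => [|E sigma r E_ge0 EL /andP[s0 sS] sol]; first lra.
rewrite lt_neqAle sqrtr_ge0 andbT; apply/eqP => r00.
have V_le u : 0 <= u < 1 -> Num.sqrt (r u) <= smax.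
  move=> /andP[u0 u1].
  have := sqrt_sol_lip hf hphi sol (b := 0) (c := u) (ltW s0).
  rewrite lexx -r00 !subr0 => /(_ u0 u1) h; rewrite (le_trans h)//.
  by rewrite (le_trans _ sS)// ger_pMr// ltW.
have [cr _ dr] := sol.
have [||c] := @MVT _ r (fun u => ode_rhs f phi E sigma u (r u)) p q pq.
- by move=> x; rewrite in_itv/= => xpq; apply: dr; lra.
- by apply: within_subspace cr; lra.
rewrite in_itv/= => cpq rpq.
have Ec : L1 + L3 + 1 <= E c by exact: EL.
have Ec0 : 0 < E c by lra.
have c01 : 0 <= c < 1 by lra.
have ratio_ge : c0 * E c <= ratio_g phi (E c) (r c).
  have [rc|rc] := ltP 0 (r c); last first.
    by rewrite ratio_g_le0// mulrC ler_wpM2l// ltW.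
  have Vc : Num.sqrt (r c) < E c * phi 1.
    rewrite (le_lt_trans (V_le c c01))// -ltr_pdivrMr// -/L1; lra.
  have phi1' : phi 1 < 1 by have [/(_ 1)/andP[]] := hphi.
  have VE : Num.sqrt (r c) < E c by rewrite (lt_trans Vc)// gtr_pMr.
  have [|s [s_gt0 sE h]] := @recip_gP _ _ hphi (E c) (Num.sqrt (r c)).
    by rewrite sqrtr_gt0 rc.
  rewrite /ratio_g rc h ler_pdivlMr// -sE mulrAC mulrC ler_pM2l//.
  by apply: phic; rewrite s_gt0 ltW// -(phi_lt hphi) -(ltr_pM2l Ec0) sE.
have mfc : m <= f c by apply: tmin; rewrite in_itv/=; lra.
have L3E : 2 * m * c0 * L3 = 2 * smax ^+ 2 + L2.
  by rewrite mulrC divfK// gt_eqF// !mulr_gt0.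
have h1 : 2 * smax ^+ 2 + L2 <= 2 * f c * ratio_g phi (E c) (r c).
  have L3r : c0 * L3 <= ratio_g phi (E c) (r c).
    by apply: le_trans ratio_ge; rewrite ler_pM2l//; lra.
  rewrite -L3E -(mulrA (2 * m)); apply: ler_pM L3r; last by lra.
    by rewrite mulr_ge0// ltW.
  by rewrite mulr_ge0// ltW.
have h2 : 2 * sigma * Num.sqrt (r c) <= 2 * smax ^+ 2.
  by rewrite -mulrA ler_pM2l// expr2 ler_pM ?sqrtr_ge0 ?V_le// ltW.
have L2E : L2 * (q - p) = smax ^+ 2 + 1 by rewrite divfK// gt_eqF// subr_gt0.
have h3 : ode_rhs f phi E sigma c (r c) * (q - p) <= - L2 * (q - p).
  by apply: ler_wpM2r; [rewrite subr_ge0 ltW|rewrite /ode_rhs; lra].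
have rq : 0 <= r q by apply: (ode_sol_ge0 hf hphi E_ge0 sol); lra.
have rp : 0 <= r p by apply: (ode_sol_ge0 hf hphi E_ge0 sol); lra.
have : r p <= smax ^+ 2.
  rewrite -(sqr_sqrtr rp) lerXn2r ?nnegrE ?sqrtr_ge0 ?(ltW S0)//.
  by rewrite V_le//; lra.
lra.
Qed.

(** * The minimal speed *)

Lemma sigma_sP (R : realType) (f phi E : R -> R) :
  sigma_s f phi E = +oo%E \/
  exists sigma : R, [/\ sigma_s f phi E = sigma%:E, 0 < sigma &
    Vsol f phi E sigma 0 = 0].
Proof.
rewrite /sigma_s; case: xgetP => [x _ [sigma [[s0 V0] _] <-]|_]; last by left.
by right; exists sigma.
Qed.

(** For s <= t, V_s(0) <= V_t(0) + t - s. Taking s = 0 bounds the admissible speeds below by V_0(0)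
    > 0; taking s = inf S and t in S near it shows that the infimum is attained. *)
Lemma sigma_s_fin (R : realType) (f phi E : R -> R) (sigma0 : R) :
  reaction f -> flux_limiter phi ->
  {within `[0, 1]%classic, continuous E} ->
  (forall u : R, 0 <= u <= 1 -> 0 <= E u) ->
  0 < Vsol f phi E 0 0 -> 0 < sigma0 -> Vsol f phi E sigma0 0 = 0 ->
  sigma_s f phi E <> +oo%E.
Proof.
move=> hf hphi cE E_ge0 V0 s0 Vs0.
have cf : {within `[0, 1]%classic, continuous f}.
  by apply: C1_01_continuous; case: hf.
pose S := [set sigma : R | 0 < sigma /\ Vsol f phi E sigma 0 = 0].
have V_le (s t : R) : 0 <= s -> s <= t ->
    Vsol f phi E s 0 <= Vsol f phi E t 0 + (t - s).
  move=> ss st; have tt := le_trans ss st.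
  apply: (sol_le_speed hf hphi E_ge0 (Rsol_ode_sol hf hphi cE E_ge0 cf ss)
            (Rsol_ode_sol hf hphi cE E_ge0 cf tt)).
  by rewrite ss.
have S0 : S !=set0 by exists sigma0.
have Slb : lbound S (Vsol f phi E 0 0).
  by move=> t [t0 Vt]; have := V_le 0 t (lexx 0) (ltW t0); rewrite Vt add0r subr0.
have hS : has_inf S by split => //; exists (Vsol f phi E 0 0).
have i_gt0 : 0 < inf S by apply: lt_le_trans V0 _; apply: lb_le_inf.
have Vi : Vsol f phi E (inf S) 0 = 0.
  apply/eqP; rewrite eq_le sqrtr_ge0 andbT; apply/ler_addgt0Pr => e e0.
  have [t [t0 Vt] te] := inf_adherent e0 hS.
  have it : inf S <= t by apply: ge_inf; [case: hS|].
  apply: le_trans (V_le _ _ (ltW i_gt0) it) _.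
  by rewrite Vt lerD2l lerBlDl ltW.
rewrite /sigma_s; case: xgetP => [x -> [s _ <-]//|/(_ (inf S)%:E) H _].
apply: H; exists (inf S) => //; split => // t St.
by apply: ge_inf; [case: hS|].
Qed.

(** * Finiteness of the speed for the glued function *)

(** The default of [xget] in [alpha_] is 0, so a positive value certifies that the minimum
    exists. *)
Lemma alpha_gt0P (R : realType) (f phi D1 : R -> R) (sigma : R) :
  0 < alpha_ f phi D1 sigma ->
  minima [set a | 0 <= a < 1 /\
    forall u : R, a < u < 1 -> 0 < Vsol f phi D1 sigma u < D1 u]
    (alpha_ f phi D1 sigma).
Proof. by rewrite /alpha_; case: xgetP => [x -> //|_]; rewrite ltxx. Qed.

(** The line of slope sigma through (u2, 0) meets the graph of V at a. On [u2, a], D1 is below it by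
    convexity and V above it by the slope bound, so V >= D1, V' = sigma, and V is the line
    itself. *)
Lemma Vsol_beta_eq0 (R : realType) (f phi D1 : R -> R) (u1 u2 sigma : R) :
  reaction f -> flux_limiter phi -> [/\ 0 < u2, u2 < u1 & u1 < 1] ->
  C2_01 D1 -> (forall u : R, 0 <= u <= u1 -> D1 u = 0) ->
  (forall u : R, u1 < u <= 1 -> 0 < deriv01 (deriv01 D1) u) ->
  0 < sigma -> beta_ f phi D1 sigma = u2 -> Vsol f phi D1 sigma u2 = 0.
Proof.
move=> hf hphi [u20 u21 u11] D1C2 D10 D1cvx s0; rewrite /beta_.
set a := alpha_ f phi D1 sigma => betaE.
have u1_itv : 0 < u1 < 1 by lra.
have cf : {within `[0, 1]%classic, continuous f}.
  by apply: C1_01_continuous; case: hf.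
have cD1 : {within `[0, 1]%classic, continuous D1}.
  by apply: C1_01_continuous; case: D1C2.
have D1_ge0 := flat_convex_ge0 u1_itv D1C2 D10 D1cvx.
have sol := Rsol_ode_sol hf hphi cD1 D1_ge0 cf (ltW s0).
have Va : Vsol f phi D1 sigma a = sigma * (a - u2).
  by rewrite -betaE; field; rewrite gt_eqF.
have au2 : u2 <= a.
  have : 0 <= sigma * (a - u2) by rewrite -Va sqrtr_ge0.
  by rewrite pmulr_rge0// subr_ge0.
have a0 : 0 < a by lra.
have [[/andP[_ a1] aV] amin] := alpha_gt0P a0.
rewrite -/a in a1 aV amin.
have au1 : u1 <= a.
  rewrite leNgt; apply/negP => alt.
  have := aV ((a + u1) / 2); rewrite D10; last lra.
  by move=> /(_ ltac:(lra)); lra.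
have Va_gt0 : 0 < Vsol f phi D1 sigma a by rewrite Va mulr_gt0//; lra.
have [cr _ _] := sol.
have cV : {within `[0, 1]%classic, continuous (Vsol f phi D1 sigma)}.
  exact: within_continuous_sqrt cr.
(* Otherwise 0 < V < D1 would extend by continuity to the left of a, against minimality. *)
have D1a : D1 a <= sigma * (a - u2).
  rewrite -Va leNgt; apply/negP => VD.
  have cDV : {within `[0, 1]%classic, continuous
      (fun x => D1 x - Vsol f phi D1 sigma x)}.
    apply: within_continuousD; first exact: cD1.
    by move=> x; apply: cvgN; exact: cV.
  have a01 : 0 <= a <= 1 by lra.
  have [d1 d10 H1] := within_gt0_near cV a01 Va_gt0.
  have DV0 : 0 < D1 a - Vsol f phi D1 sigma a by rewrite subr_gt0.
  have [d2 d20 H2] := within_gt0_near cDV a01 DV0.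
  pose d := Num.min (Num.min d1 d2) a.
  have dgt0 : 0 < d by rewrite !lt_min d10 d20.
  have [dd1 dd2 da] : [/\ d <= d1, d <= d2 & d <= a].
    by rewrite !ge_min !lexx !orbT.
  have : a <= a - d / 2.
    apply: amin; split=> [|x xd]; first lra.
    have [xa|xa] := ltP a x; first by apply: aV; lra.
    have x01 : 0 <= x <= 1 by lra.
    have xad : `|x - a| < d by rewrite ltr_norml; lra.
    rewrite H1 ?(lt_le_trans xad)//= -subr_gt0.
    by apply: H2; rewrite ?(lt_le_trans xad).
  by lra.
have Dline x : u2 <= x <= a -> D1 x <= sigma * (x - u2).
  move=> xa; apply: (flat_convex_chord u1_itv D1C2 D10 D1cvx) D1a xa => //.
    by lra.
  exact: ltW.
move: au2; rewrite le_eqVlt => /predU1P[E|u2a].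
  by move: Va; rewrite -E subrr mulr0.
have Vline x : u2 <= x <= a -> sigma * (x - u2) <= Vsol f phi D1 sigma x.
  move=> /andP[x1 x2].
  have := sqrt_sol_lip hf hphi sol (b := x) (c := a) (ltW s0).
  by rewrite -/(Vsol f phi D1 sigma a) -/(Vsol f phi D1 sigma x) Va; lra.
have [||c _] := @MVT _ (Vsol f phi D1 sigma) (cst sigma) u2 a u2a.
- move=> x; rewrite in_itv/= => xu.
  have x01 : 0 < x < 1 by lra.
  have xline : 0 < sigma * (x - u2) by rewrite mulr_gt0//; lra.
  have Vx : sigma * (x - u2) <= Vsol f phi D1 sigma x by apply: Vline; lra.
  have rx : 0 < Rsol f phi D1 sigma x.
    by rewrite -sqrtr_gt0; exact: lt_le_trans xline Vx.
  have := is_derive_sqrt_sol sol x01 rx.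
  rewrite recip_g_eq0 ?mulr0 ?subr0//.
  by apply: le_trans Vx; apply: Dline; lra.
- by apply: within_subspace cV; lra.
by rewrite Va /cst; lra.
Qed.

Lemma sigma_s_glueD_fin (R : realType) (f phi D1 D2 : R -> R)
    (u1 u2 sigmat : R) :
  reaction f -> flux_limiter phi -> [/\ 0 < u2, u2 < u1 & u1 < 1] ->
  C2_01 D1 -> (forall u : R, 0 <= u <= u1 -> D1 u = 0) ->
  (forall u : R, u1 < u <= 1 -> 0 < deriv01 (deriv01 D1) u) ->
  {within `[0, 1]%classic, continuous D2} ->
  (forall u : R, 0 <= u <= 1 -> 0 <= D2 u) ->
  {within `[0, 1]%classic, continuous (glueD u2 u1 D2 D1)} ->
  0 < sigmat -> beta_ f phi D1 sigmat = u2 ->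
  (sigma_s f phi D2 < sigmat%:E)%E ->
  0 < Vsol f phi (glueD u2 u1 D2 D1) 0 0 ->
  sigma_s f phi (glueD u2 u1 D2 D1) <> +oo%E.
Proof.
move=> hf hphi hu hD1 hD1_0 hD1_cvx cD2 D2_ge0 cD st0 hsigmat hD12 V0.
have V1 := Vsol_beta_eq0 hf hphi hu hD1 hD1_0 hD1_cvx st0 hsigmat.
have [u20 u21 u11] := hu; have u2_le1 := ltW (lt_trans u21 u11).
have u1_itv : 0 < u1 < 1 by rewrite u11 (lt_trans u20).
have D1_ge0 := flat_convex_ge0 u1_itv hD1 hD1_0 hD1_cvx.
have D_ge0 (u : R) : 0 <= u <= 1 -> 0 <= glueD u2 u1 D2 D1 u.
  move=> u01; rewrite /glueD; case: ifPn => _; first exact: D2_ge0.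
  by case: ifPn => // _; exact: D1_ge0.
have cf : {within `[0, 1]%classic, continuous f}.
  by apply: C1_01_continuous; case: hf.
have cD1 : {within `[0, 1]%classic, continuous D1}.
  by apply: C1_01_continuous; case: hD1.
suff Vt : Vsol f phi (glueD u2 u1 D2 D1) sigmat 0 = 0.
  exact: (sigma_s_fin hf hphi cD D_ge0 V0 st0 Vt).
have st0' := ltW st0; have stst : 0 <= sigmat <= sigmat by rewrite st0' lexx.
have sol := Rsol_ode_sol hf hphi cD D_ge0 cf st0'.
have sol1 := Rsol_ode_sol hf hphi cD1 D1_ge0 cf st0'.
have sol2 := Rsol_ode_sol hf hphi cD2 D2_ge0 cf st0'.
have Vu2 : Vsol f phi (glueD u2 u1 D2 D1) sigmat u2 <= 0.
  rewrite -[leRHS]V1.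
  apply: (sol_le hf hphi D_ge0 D1_ge0 sol sol1 stst (ltW u20) u2_le1 (lexx 1)).
    move=> u /andP[u2u _]; rewrite /glueD ltNge (ltW u2u)/=.
    by case: ifPn => // uu1; rewrite hD1_0// uu1 (ltW (lt_trans u20 u2u)).
  by have [_ -> _] := sol; rewrite sqrtr0 sqrtr_ge0.
have [D2E|[s2 [s2E s20 V20]]] := sigma_sP f phi D2.
  by move: hD12; rewrite D2E.
(* A larger speed gives a smaller V, so V for D2 still vanishes at 0 at speed [sigmat]. *)
have s2t : 0 <= s2 <= sigmat by rewrite !ltW// -lte_fin -s2E.
have sol2' := Rsol_ode_sol hf hphi cD2 D2_ge0 cf (ltW s20).
have V2 : Vsol f phi D2 sigmat 0 <= 0.
  rewrite -[leRHS]V20.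
  apply: (sol_le hf hphi D2_ge0 D2_ge0 sol2 sol2' s2t (lexx 0) ler01 (lexx 1)).
    by [].
  by have [_ -> _] := sol2; rewrite sqrtr0 sqrtr_ge0.
apply: le_anti; rewrite sqrtr_ge0 andbT; apply: le_trans V2.
apply: (sol_le hf hphi D_ge0 D2_ge0 sol sol2 stst (lexx 0) (ltW u20) u2_le1).
  by move=> u /andP[_ uu2]; rewrite /glueD uu2.
by apply: le_trans Vu2 _; rewrite sqrtr_ge0.
Qed.

(** The midpoint of [a, b] is in the closure of the nonzero set, so some point of (a, b) has h > 0;
    half of that value bounds h below nearby. *)
Lemma support01_gt0_itv (R : realType) (h : R -> R) (a b : R) :
  {within `[0, 1]%classic, continuous h} ->
  (forall u : R, 0 <= u <= 1 -> 0 <= h u) -> 0 < a -> a < b -> b < 1 ->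
  support01 h = `[a, b]%classic ->
  exists p q m : R, [/\ 0 < p, p < q, q < 1, 0 < m &
    forall u : R, p < u < q -> m <= h u].
Proof.
move=> ch h_ge0 a0 ab b1 hsupp.
have [p0 p0ab hp0] : exists2 p0, a < p0 < b & 0 < h p0.
  have mcl : support01 h ((a + b) / 2).
    by rewrite hsupp /= in_itv/=; lra.
  have mab : (a + b) / 2 \in `]a, b[ by rewrite in_itv/=; lra.
  have [p0 [[p01 hp] p0ab]] := mcl _ (near_in_itvoo mab).
  exists p0; first by move: p0ab; rewrite /= in_itv.
  by rewrite lt_neqAle eq_sym hp h_ge0.
have p001 : 0 <= p0 <= 1 by lra.
pose m := h p0 / 2.
have chm : {within `[0, 1]%classic, continuous (fun x => h x + - m)}.
  apply: within_continuousD => //.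
  by apply: continuous_subspaceT => x; exact: cvg_cst.
have hm0 : 0 < h p0 + - m by rewrite /m; lra.
have [d d0 Hd] := within_gt0_near chm p001 hm0.
pose M := Num.min d (Num.min p0 (1 - p0)).
have M0 : 0 < M by rewrite !lt_min d0; lra.
have [Md Mp Mp'] : [/\ M <= d, M <= p0 & M <= 1 - p0].
  by rewrite !ge_min !lexx !orbT.
clearbody M; exists (p0 - M / 2), (p0 + M / 2), m.
split; [lra|lra|lra|by rewrite /m; lra|move=> u upq].
have u01 : 0 <= u <= 1 by lra.
have ud : `|u - p0| < d by rewrite ltr_norml; lra.
by have := Hd u u01 ud; lra.
Qed.

Unset Implicit Arguments.

Theorem lemma7p8 (R : realType) (f phi : R -> R)
    (hf : reaction f) (hphi : flux_limiter phi)
    (* the function D *)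
    (u1 u2 : R) (hu : [/\ 0 < u2, u2 < u1 & u1 < 1])
    (D1 D2 : R -> R)
    (hD1 : C2_01 D1)
    (hD1_0 : forall u : R, 0 <= u <= u1 -> D1 u = 0)
    (hD1_cvx : forall u : R, u1 < u <= 1 -> 0 < deriv01 (deriv01 D1) u)
    (hD2 : C2_01 D2)
    (hD2_ge0 : forall u : R, 0 <= u <= 1 -> 0 <= D2 u)
    (hD2_0 : forall u : R, u2 <= u <= 1 -> D2 u = 0)
    (hD2_cvx : forall u : R, 0 < u < u2 -> 0 < deriv01 (deriv01 D2) u)
    (* tau, sigma-tilde and the standing assumption on D1, D2 *)
    (tau : R) (htau_gt0 : 0 < tau)
    (htau : tau = deriv01 D1 (alpha_ f phi D1 tau))
    (sigmat : R) (hsigmat_range : 0 < sigmat < tau)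
    (hsigmat : beta_ f phi D1 sigmat = u2)
    (hD12 : (sigma_s f phi D2 < sigmat%:E)%E)
    (* D, sigma-bar, Upsilon, gamma, alpha *)
    (D : R -> R) (hD : D = glueD u2 u1 D2 D1)
    (sigmabar : \bar R) (hsigmabar : sigmabar = sigma_s f phi D)
    (Upsilon : R -> R) (hUpsilon : Upsilon = Vsol f phi D (fine sigmabar))
    (gamma alpha : R)
    (hgamma : 0 < gamma < u2) (halpha : u1 < alpha < 1)
    (hUpsilon_gt : forall u : R, gamma < u < alpha -> D u < Upsilon u)
    (hUpsilon_lt : forall u : R, (0 <= u < gamma) || (alpha < u <= 1) ->
       Upsilon u < D u)
    (* the perturbation *)
    (Dt : R -> R) (delta kappa : R)
    (hDt : C2_01 Dt)
    (hDt_ge0 : forall u : R, 0 <= u <= 1 -> 0 <= Dt u)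
    (hdelta : gamma < delta < u2) (hkappa : u1 < kappa < alpha)
    (hDt_supp : support01 Dt = `[delta, kappa]%classic)
    (hreg : forall lambda : R, 0 < lambda ->
       regular_flux (flux (Dlam D Dt lambda) phi) /\
       {within `[0, 1]%classic, continuous (Dlam D Dt lambda)}) :
  exists Lambda : R, 0 < Lambda /\ forall lambda : R, Lambda < lambda ->
    (sigmabar < sigma_s f phi (Dlam D Dt lambda))%E.
Proof.
have [u20 u21 u11] := hu.
have [/andP[g0 _] /andP[_ a1]] := (hgamma, halpha).
have [[/andP[gd du2] /andP[uk ka]] /andP[st0 _]] := (hdelta, hkappa, hsigmat_range).
have u1_itv : 0 < u1 < 1 by rewrite u11 (lt_trans u20).
have D1_ge0 := flat_convex_ge0 u1_itv hD1 hD1_0 hD1_cvx.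
have cf : {within `[0, 1]%classic, continuous f}.
  by apply: C1_01_continuous; case: hf.
have cD2 : {within `[0, 1]%classic, continuous D2}.
  by apply: C1_01_continuous; case: hD2.
have cDt : {within `[0, 1]%classic, continuous Dt}.
  by apply: C1_01_continuous; case: hDt.
have D_ge0 (u : R) : 0 <= u <= 1 -> 0 <= D u.
  move=> u01; rewrite hD /glueD; case: ifPn => _; first exact: hD2_ge0.
  by case: ifPn => // _; exact: D1_ge0.
have cD : {within `[0, 1]%classic, continuous D}.
  (* Continuity of D, including at the gluing points, is recovered from D + Dt by subtracting Dt. *)
  have [_ cD1'] := hreg 1 ltr01.
  have -> : D = (fun u => Dlam D Dt 1 u + - Dt u).
    by apply/funext => u; rewrite /Dlam mul1r addrK.
  apply: within_continuousD => //.
  by move=> x; apply: cvgN; exact: cDt.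
have [sbE|[sb [sbE sb0 _]]] := sigma_sP f phi D.
  (* In this case [fine] returns the default 0, so Upsilon has speed 0 and is nonincreasing on
     [0, u2]: V(0) >= V(u2) > D u2 >= 0. *)
  have V0 : 0 < Vsol f phi D 0 0.
    have sol := Rsol_ode_sol hf hphi cD D_ge0 cf (lexx 0).
    have /andP[ug gu] : gamma < u2 < alpha.
      by rewrite (lt_trans gd du2) (lt_trans u21 (lt_trans uk ka)).
    have u201 : 0 <= u2 <= 1 by rewrite !ltW// (lt_trans u21).
    have := hUpsilon_gt u2; rewrite hUpsilon hsigmabar sbE /= ug gu => /(_ isT).
    move=> /(le_lt_trans (D_ge0 _ u201)) Vu2; apply: lt_le_trans Vu2 _.
    have u2_ge0 : 0 <= (0 : R) <= u2 by rewrite lexx ltW.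
    have := sqrt_sol_lip hf hphi sol (lexx 0) u2_ge0 (lt_trans u21 u11).
    by rewrite mul0r subr_le0.
  exfalso; move: V0 sbE cD; rewrite hD => V0 sbE cD.
  exact: (sigma_s_glueD_fin hf hphi hu hD1 hD1_0 hD1_cvx cD2 hD2_ge0 cD st0
            hsigmat hD12 V0 sbE).
have [p [q [m [p0 pq q1 m0 Dtm]]]] := support01_gt0_itv cDt hDt_ge0
  (lt_trans g0 gd) (lt_trans du2 (lt_trans u21 uk)) (lt_trans ka a1) hDt_supp.
have [L L0 HL] := sol_gt0_of_large_flux hf hphi p0 pq q1 sb0.
(* Since Dt >= m on (p, q), lambda > L / m lifts D + lambda Dt above the threshold [L] there. *)
exists (L / m); split; first exact: divr_gt0.
move=> lambda; rewrite ltr_pdivrMr// => Llam.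
have lam0 : 0 < lambda by rewrite -(pmulr_lgt0 _ m0); exact: lt_trans Llam.
have Dlam_ge0 (u : R) : 0 <= u <= 1 -> 0 <= Dlam D Dt lambda u.
  by move=> u01; rewrite /Dlam addr_ge0 ?D_ge0// mulr_ge0 ?(ltW lam0) ?hDt_ge0.
rewrite hsigmabar sbE.
have [->|[s [-> s0 Vs]]] := sigma_sP f phi (Dlam D Dt lambda); first exact: ltry.
rewrite lte_fin ltNge; apply/negP => ssb.
have [_ cDl] := hreg lambda lam0.
have ssb' : 0 < s <= sb by rewrite s0.
suff Dlam_ge (u : R) : p < u < q -> L <= Dlam D Dt lambda u.
  have sol := Rsol_ode_sol hf hphi cDl Dlam_ge0 cf (ltW s0).
  have := HL _ s _ Dlam_ge0 Dlam_ge ssb' sol.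
  by rewrite -/(Vsol f phi (Dlam D Dt lambda) s 0) Vs ltxx.
move=> upq; have /andP[pu uq] := upq.
have u01 : 0 <= u <= 1 by rewrite (ltW (lt_trans p0 pu)) (ltW (lt_trans uq q1)).
rewrite /Dlam (le_trans (ltW Llam))// ler_wpDl ?D_ge0//.
by rewrite ler_pM2l// Dtm.
Qed.
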